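(* Let $\{w_i\}_{i=1}^n$ be a basis of $\mathbb{R}^n$ and let $S\subseteq[n]$ have cardinality $|S|=d$. Let $(S_1,\dots,S_m)$ form a uniform cover of $S$ with weights $(p_1,\dots,p_m)$. Set $H=\mathrm{span}\{w_k : k\in S\}$, $H_j=\mathrm{span}\{w_k : k\in S_j\}$, $\widetilde{H}_j=\mathrm{span}\{w_k : k\in S\setminus S_j\}$, $d_j=\dim H_j=|S_j|$, $\widetilde{d}_j=\dim\widetilde{H}_j=d-d_j$ and $p=\sum_{j=1}^m p_j$. Put $$BL_1:=\frac{\prod_{j=1}^m|\wedge_{k\in S\setminus S_j}w_k|^{p_j}}{|\wedge_{i\in S}w_i|^{p-1}},\qquad BL_2:=\frac{\prod_{j=1}^m|\wedge_{k\in S_j}w_k|^{p_j}}{|\wedge_{i\in S}w_i|}.$$ Then for every convex body $K\subseteq\mathbb{R}^n$ the following four inequalities hold: $$\max_{x\in H}|K\cap(x+H^\perp)|^{p-1}|K|\geqslant\frac{1}{BL_1}\cdot\frac{\prod_{j=1}^m d_j^{\,p_jd_j}}{d^d}\prod_{j=1}^m|K\cap\widetilde{H}_j^\perp|^{p_j},$$ $$\max_{x\in H}|K\cap(x+H^\perp)||K|^{p-1}\geqslant\frac{1}{BL_2}\cdot\frac{\prod_{j=1}^m\widetilde{d}_j^{\,p_j\widetilde{d}_j}}{d^{d(p-1)}}\prod_{j=1}^m|K\cap H_j^\perp|^{p_j},$$ $$\max_{x\in H}|K\cap(x+H^\perp)|^{p-1}|K|\geqslant\frac{1}{BL_2}\cdot\frac{\prod_{j=1}^m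 d_j^{\,p_jd_j}}{d^d}\prod_{j=1}^m|K\cap(H_j\oplus H^\perp)|^{p_j},$$ $$\max_{x\in H}|K\cap(x+H^\perp)||K|^{p-1}\geqslant\frac{1}{BL_1}\cdot\frac{\prod_{j=1}^m\widetilde{d}_j^{\,p_j\widetilde{d}_j}}{d^{d(p-1)}}\prod_{j=1}^m|K\cap(\widetilde{H}_j\oplus H^\perp)|^{p_j}.$$
   Context: $[n]=\{1,\dots,n\}$. For $m\geqslant1$, subsets $S_1,\dots,S_m\subseteq S$ (not necessarily distinct) form a uniform cover of $S\subseteq[n]$ with weights $(p_1,\dots,p_m)$, $p_j>0$ for all $j$, if $\sum_{j=1}^m p_j\chi_{S_j}(i)=1$ for every $i\in S$. For vectors $u_1,\dots,u_k$, $|\wedge_{i=1}^k u_i|$ is the $k$-dimensional volume of the parallelepiped they span (equal to $1$ for the empty family). A convex body is a compact convex set with non-empty interior. $F^\perp$ is the orthogonal complement in $\mathbb{R}^n$ of the linear subspace $F$, and $|\cdot|$ of a set denotes Lebesgue measure in the corresponding (affine) subspace (unit point mass on a point). Convention: $0^0=1$. *)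

(* Defs.v *)
From HB Require Import structures.
From mathcomp Require Import all_boot all_order all_algebra.
From mathcomp Require Import all_classical all_reals all_analysis.

Set Implicit Arguments.
Unset Strict Implicit.
Unset Printing Implicit Defensive.

Import Order.TTheory GRing.Theory Num.Theory.
Import numFieldNormedType.Exports.

Local Open Scope classical_set_scope.
Local Open Scope ring_scope.

Section lebesgue_rV.
Variable R : realType.

(* MathComp-Analysis has binary product measures only: R^k is built as the
   iterated product R * (R * ... * (R * unit)), with the Dirac mass on [unit]
   as the measure of R^0, and then transported to row vectors. *)
Fixpoint Rpow_display (k : nat) : measure_display :=
  if k is k'.+1 then
    measure_prod_display
      (sigma_display (@measurable _ (ocitv_type R)), Rpow_display k')
  else default_measure_display.

Fixpoint Rpow (k : nat) : measurableType (Rpow_display k) :=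
  if k is k'.+1 then (measurableTypeR R * Rpow k')%type : measurableType _
  else unit : measurableType _.

Fixpoint Rpow_lebesgue (k : nat) : set (Rpow k) -> \bar R :=
  match k return set (Rpow k) -> \bar R with
  | 0 => \d_tt
  | k'.+1 => (@lebesgue_measure R \x @Rpow_lebesgue k')%E
  end.

Fixpoint Rpow_rV (k : nat) : Rpow k -> 'rV[R]_k :=
  match k return Rpow k -> 'rV[R]_k with
  | 0 => fun=> 0
  | k'.+1 => fun t => row_mx (const_mx t.1 : 'rV_1) (Rpow_rV t.2)
  end.

Definition lebesgue_rV (k : nat) (A : set 'rV[R]_k) : \bar R :=
  Rpow_lebesgue (@Rpow_rV k @^-1` A).

End lebesgue_rV.

Section euclidean.
Variables (R : realType) (n : nat).
Implicit Types (u v x : 'rV[R]_n) (F : {vspace 'rV[R]_n}).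

Definition dotv u v : R := (u *m v^T) 0 0.

Lemma dotvE u v : dotv u v = \sum_(i < n) u 0 i * v 0 i.
Proof. by rewrite /dotv mxE; apply: eq_bigr => i _; rewrite mxE. Qed.

Lemma dotvC u v : dotv u v = dotv v u.
Proof. by rewrite !dotvE; apply: eq_bigr => i _; rewrite mulrC. Qed.

Lemma dotvDl u v x : dotv (u + v) x = dotv u x + dotv v x.
Proof. by rewrite /dotv mulmxDl mxE. Qed.

Lemma dotvZl a u x : dotv (a *: u) x = a * dotv u x.
Proof. by rewrite /dotv -scalemxAl mxE. Qed.

Lemma dotv_eq0 u : (dotv u u == 0) = (u == 0).
Proof.
rewrite dotvE; apply/eqP/eqP => [|->]; last by rewrite big1// => i _; rewrite mxE mul0r.
move=> /psumr_eq0P u0; apply/rowP => i; rewrite mxE.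
by apply/eqP; rewrite -sqrf_eq0 expr2 u0// => j _; rewrite -expr2 sqr_ge0.
Qed.

Lemma dotv_ge0 u : 0 <= dotv u u.
Proof. by rewrite dotvE sumr_ge0// => i _; rewrite -expr2 sqr_ge0. Qed.

Definition orthv F : {vspace 'rV[R]_n} :=
  lker (linfun (mulmxr (\matrix_(i < \dim F) (vbasis F)`_i)^T)).

Lemma orthvP F v :
  reflect (forall u, u \in F -> dotv v u = 0) (v \in orthv F).
Proof.
rewrite memv_ker lfunE /=.
have E (i : 'I_(\dim F)) :
    (v *m (\matrix_(i < \dim F) (vbasis F)`_i)^T) 0 i = dotv v (vbasis F)`_i.
  by rewrite mxE dotvE; apply: eq_bigr => j _; rewrite !mxE.
apply: (iffP eqP) => [v0 u uF|v0].
  rewrite (coord_vbasis uF) dotvC; elim/big_ind: _.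
  - by rewrite /dotv mul0mx mxE.
  - by move=> a b a0 b0; rewrite dotvDl a0 b0 addr0.
  - by move=> i _; rewrite dotvZl dotvC -E v0 mxE mulr0.
apply/rowP => i; rewrite E mxE v0// vbasis_mem//.
by rewrite mem_nth// size_tuple.
Qed.

Definition orthonormal_basis F (e : (\dim F).-tuple 'rV[R]_n) :=
  basis_of F e /\ forall i j, dotv (tnth e i) (tnth e j) = (i == j)%:R.

Lemma orthonormal_basis_exists F : exists e, @orthonormal_basis F e.
Proof.
suff [e [eF edot]] : exists e : seq 'rV[R]_n, basis_of F e /\
    forall i j, (i < size e)%N -> (j < size e)%N ->
      dotv e`_i e`_j = (i == j)%:R.
  have se : size e == \dim F by rewrite (size_basis (X := in_tuple e)).
  exists (Tuple se); split=> // i j.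
  by rewrite !(tnth_nth 0)/= edot// (eqP se) ltn_ord.
move: {2}(\dim F) (erefl (\dim F)) => d; elim: d F => [|d IH] F dF.
  exists [::]; split=> //.
  by move/eqP: dF; rewrite dimv_eq0 => /eqP ->; rewrite nil_basis.
pose v := vpick F.
have v0 : v != 0 by rewrite vpick0 -dimv_eq0 dF.
pose u := (Num.sqrt (dotv v v))^-1 *: v.
have nv0 : Num.sqrt (dotv v v) != 0.
  by rewrite sqrtr_eq0 -ltNge lt_neqAle eq_sym dotv_eq0 v0 dotv_ge0.
have uu : dotv u u = 1.
  rewrite /u dotvZl dotvC dotvZl mulrA -{3}(sqr_sqrtr (dotv_ge0 v)) expr2.
  by rewrite mulrACA mulVf// mulr1.
have u0 : u != 0 by rewrite -dotv_eq0 uu oner_eq0.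
have uF : u \in F by rewrite memvZ// memv_pick.
pose G := (F :&: orthv <[u]>)%VS.
have FE : F = (<[u]> + G)%VS.
  apply/eqP; rewrite eqEsubv subv_add -memvE uF capvSl !andbT.
  apply/subvP => x xF; rewrite -[x](subrK (dotv x u *: u)) addrC memv_add//.
    by rewrite memvZ// memv_line.
  rewrite memv_cap; apply/andP; split; first exact: rpredB xF (memvZ _ uF).
  apply/orthvP => _ /vlineP[k ->].
  by rewrite dotvC dotvZl dotvC dotvDl -scaleNr dotvZl uu mulr1 subrr mulr0.
have uG : (<[u]> :&: G = 0)%VS.
  apply/eqP; rewrite -subv0; apply/subvP => x; rewrite !memv_cap.
  move=> /and3P[/vlineP[k ->] _ /orthvP/(_ _ (memv_line u))].
  by rewrite dotvZl uu mulr1 => ->; rewrite scale0r mem0v.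
have dG : \dim G = d.
  by apply/eqP; rewrite -eqSS -dF FE dimv_disjoint_sum// dim_vline u0.
have [e [eG edot]] := IH G dG.
exists (u :: e); split.
  rewrite FE -cat1s cat_basis// ?seq1_basis//.
  by apply/directv_addP.
have ue i : (i < size e)%N -> dotv u e`_i = 0.
  move=> ie; have : e`_i \in G by rewrite (basis_mem eG)// mem_nth.
  rewrite memv_cap => /andP[_ /orthvP/(_ _ (memv_line u))].
  by rewrite dotvC.
case=> [|i] [|j] //= ie je; last by rewrite eqSS edot.
- by rewrite ue.
- by rewrite dotvC ue.
Qed.

Definition onb F : (\dim F).-tuple 'rV[R]_n :=
  xget (vbasis F) [set e | @orthonormal_basis F e].

Lemma onbP F : orthonormal_basis (onb F).
Proof.
have [e he] := orthonormal_basis_exists F.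
by apply: (@xgetPex _ (vbasis F) [set e | @orthonormal_basis F e]); exists e.
Qed.

(* Lebesgue measure of [A `&` (x + F)] in the affine subspace [x + F], computed
   in orthonormal coordinates.  Because of [fine], it is meaningful for sets
   with bounded intersection with [x + F] only. *)
Definition affine_vol F x (A : set 'rV[R]_n) : R :=
  fine (lebesgue_rV [set t : 'rV[R]_(\dim F) |
                      A (x + \sum_i t 0 i *: tnth (onb F) i)]).

Definition vol (A : set 'rV[R]_n) : R := fine (lebesgue_rV A).

Definition convex_body (K : set 'rV[R]_n) :=
  [/\ compact K, convex_set K & interior K !=set0].

End euclidean.

Section families.
Variables (R : realType) (n : nat).
Implicit Types (w : 'I_n -> 'rV[R]_n) (A : {set 'I_n}).

Definition spanv w A : {vspace 'rV[R]_n} := <<[seq w k | k in A]>>%VS.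

Definition parallelepiped w A : set 'rV[R]_n :=
  [set \sum_(k in A) t k *: w k | t in [set t : 'I_n -> R |
                                         forall k, 0 <= t k <= 1]].

(* For a linearly dependent family, the #|A|-dimensional volume vanishes, while
   [affine_vol] below would be taken in dimension [\dim (spanv w A) < #|A|]. *)
Definition wedge_vol w A : R :=
  if free [seq w k | k in A]
  then affine_vol (spanv w A) 0 (parallelepiped w A) else 0.

Definition uniform_cover m (S : {set 'I_n}) (C : 'I_m -> {set 'I_n})
    (p : 'I_m -> R) :=
  [/\ (0 < m)%N, forall j, C j \subset S, forall j, 0 < p j
    & forall i, i \in S -> \sum_(j < m) p j * (i \in C j)%:R = 1].

End families.

Definition is_max (R : realType) (A : set R) (M : R) := A M /\ ubound A M.

(* Main.v *)
From HB Require Import structures.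
Require Import Defs.
From mathcomp Require Import all_boot all_order all_algebra.
From mathcomp Require Import all_classical all_reals all_analysis.
From mathcomp Require Import measurable_realfun ring lra.

Set Implicit Arguments.
Unset Strict Implicit.
Unset Printing Implicit Defensive.

Import Order.TTheory GRing.Theory Num.Theory.
Import numFieldNormedType.Exports.

Local Open Scope classical_set_scope.
Local Open Scope ring_scope.

(** Let [f x] be the volume of the section of [K] through [x] parallel to the
    orthogonal complement of [H]. By Brunn-Minkowski [f] is log-concave on [H];
    let [M] be its maximum. The subspace [Hj j + orthv H] is swept by the sections
    through the points of [Hj j], so that the third inequality compares the
    integral of [f] over [H] with its integrals over the subspaces [Hj j].

    Write [d] for the cardinality of [S] and [dj] for that of [C j]. Because the
    sets [C j] cover [S] uniformly, the numbers [q j * (dj / d)] add up to 1, and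
    log-concavity gives, for points [x j] of [Hj j],
      [f (\sum_j (q j * (dj / d)) *: x j) >= \prod_j f (x j) `^ (q j * (dj / d))
         >= M `^ (1 - p) * \prod_j f (x j) `^ q j],
    the second step because [f <= M] and [dj <= d]. On the other hand, in the
    coordinates along the vectors [w k], each coordinate of the sum of the
    [q j *: y j] is a convex combination of coordinates of those [y j] for which
    [C j] contains the index. The Prékopa-Leindler inequality, applied one
    coordinate after the other to [y j = (dj / d) *: x j]
    ([box_prekopa_leindler]), therefore bounds the integral of [f] from below by
    [M `^ (1 - p)] times the product of the integrals over the [Hj j], the
    dilations contributing the factors [(dj / d) `^ (q j * dj)]. This is
    [cover_inequality]. The log-concavity of [f] is another instance of
    [box_prekopa_leindler], applied to indicator functions.

    The other inequalities follow from this one. The complements [S :\: C j] form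
    a uniform cover with weights [q j / (p - 1)], and the inequality for it,
    raised to the power [p - 1], is the fourth one
    ([cocover_volume_inequality]). The first two are the third and the fourth for
    the basis of [H] dual to the [w k], since the orthogonal complement of the
    span of the [w k] with [k] in [S :\: C j] is spanned by the dual vectors with
    index in [C j] and by the orthogonal complement of [H].

    To treat the four cases in the same way, [w] restricted to [S] is completed
    by an orthonormal family into a basis of the whole space ([frame], with dual
    [dual_frame]). All the subspaces are then spanned by rows of one of these two
    matrices, and [affine_vol_coord] expresses volumes in them by integrals over
    coordinate subspaces, up to Gram determinants. Those are the wedge volumes
    ([wedge_volE]), and Jacobi's identity on complementary minors
    ([gram_det_dual]) exchanges the two Brascamp-Lieb constants when passing to
    the dual. *)

(** * Products of the Lebesgue measure and of Dirac masses *)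


Section mask_measure.
Variable R : realType.

Definition coord_measure (b : bool) :
    {sigma_finite_measure set (measurableTypeR R) -> \bar R} :=
  if b return {sigma_finite_measure set (measurableTypeR R) -> \bar R}
  then (@lebesgue_measure R) else \d_(0 : measurableTypeR R).

Section prod_sigma_finite.
Context d1 d2 (T1 : measurableType d1) (T2 : measurableType d2).
Variables (m1 : {sigma_finite_measure set T1 -> \bar R})
          (m2 : {sigma_finite_measure set T2 -> \bar R}).

(** Products of the two exhausting sequences exhaust the product space. *)
Lemma prod_sigma_finite : sigma_finite setT (m1 \x m2)%E.
Proof.
have /sigma_finiteP[F [FT Fnd Ffin]] := sigma_finiteT m1.
have /sigma_finiteP[G [GT Gnd Gfin]] := sigma_finiteT m2.
exists (fun k => F k `*` G k) => [|k]; last first.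
  have [mF oF] := Ffin k; have [mG oG] := Gfin k.
  split; first exact: measurableX.
  by rewrite product_measure1E// lte_mul_pinfty// ge0_fin_numE.
apply/esym/seteqP; split=> // -[x y] _.
have [i _ Fx] : (\bigcup_i F i) x by rewrite -FT.
have [j _ Gy] : (\bigcup_j G j) y by rewrite -GT.
exists (maxn i j) => //; split => /=.
- exact: (subsetPset _ _ (Fnd _ _ (leq_maxl i j))) Fx.
- exact: (subsetPset _ _ (Gnd _ _ (leq_maxr i j))) Gy.
Qed.

Let sigma_finite_mixin :=
  Measure_isSigmaFinite.Build _ _ _ (m1 \x m2)%E prod_sigma_finite.

(** The product as a bundled sigma-finite measure, the form in which it can
    be a factor of a further product. *)
Definition prod_measure : {sigma_finite_measure set (T1 * T2)%type -> \bar R} :=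
  HB.pack (m1 \x m2)%E (Measure.on (m1 \x m2)%E) sigma_finite_mixin.
End prod_sigma_finite.

(** The Lebesgue measure of the coordinate subspace on which [a] holds, as a
    measure on the whole space: the other coordinates carry a Dirac mass at 0.
    All coordinate subspaces then have the same carrier, and an induction on the
    dimension can treat several of them at once. *)
Fixpoint mask_measure (n : nat) :
    ('I_n -> bool) -> {sigma_finite_measure set (Rpow R n) -> \bar R} :=
  match n return ('I_n -> bool) -> {sigma_finite_measure set (Rpow R n) -> \bar R} with
  | 0 => fun=> \d_tt
  | n'.+1 => fun a => prod_measure (coord_measure (a ord0))
                        (mask_measure (fun i => a (lift ord0 i)))
  end.

Lemma mask_measureT n : Rpow_lebesgue (R:=R) (k:=n) = mask_measure (fun=> true).
Proof. by elim: n => //= n ->. Qed.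

Definition cons_mx n (x : R) (y : 'rV[R]_n) : 'rV[R]_n.+1 :=
  row_mx (const_mx x : 'rV_1) y.

Lemma cons_mx0 n x (y : 'rV[R]_n) : cons_mx x y 0 ord0 = x.
Proof.
have -> : ord0 = lshift n (ord0 : 'I_1) by apply: ord_inj.
by apply: etrans (row_mxEl _ _ _ _) _; rewrite mxE.
Qed.

Lemma cons_mxS n x (y : 'rV[R]_n) i : cons_mx x y 0 (lift ord0 i) = y 0 i.
Proof.
have -> : lift ord0 i = rshift 1 i by apply: ord_inj.
exact: row_mxEr.
Qed.

Fixpoint rV_Rpow n : 'rV[R]_n -> Rpow R n :=
  match n return 'rV[R]_n -> Rpow R n with
  | 0 => fun=> tt
  | n'.+1 => fun v => (v 0 0, rV_Rpow (rsubmx (v : 'rV_(1 + n'))))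
  end.

Lemma rV_RpowK n : cancel (@rV_Rpow n) (@Rpow_rV R n).
Proof.
elim: n => [v|n IH v] /=; first by apply/rowP; case.
rewrite IH; apply: etrans _ (@hsubmxK _ 1 1 n v); congr (row_mx _ _).
by apply/rowP => i; rewrite !mxE ord1; congr (v _ _); exact: ord_inj.
Qed.

Lemma measurable_coord n (i : 'I_n) :
  measurable_fun setT (fun y : Rpow R n => Rpow_rV y 0 i : measurableTypeR R).
Proof.
elim: n i => [[]//|n IH i] /=.
case: (unliftP ord0 i) => [j ->|->].
  under eq_fun do rewrite -/(cons_mx _ _) cons_mxS.
  exact: measurableT_comp (IH j) (@measurable_snd _ _ _ _).
under eq_fun do rewrite -/(cons_mx _ _) cons_mx0.
exact: measurable_fst.
Qed.

Lemma measurable_rV_Rpow d (T : measurableType d) n (phi : T -> 'rV[R]_n) :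
  (forall i, measurable_fun setT (fun t => phi t 0 i : measurableTypeR R)) ->
  measurable_fun setT (@rV_Rpow n \o phi).
Proof.
elim: n phi => [phi _|n IH phi mphi] /=; first exact: measurable_cst.
apply: measurable_fun_pair; first exact: mphi.
apply: (IH (fun t => rsubmx (phi t : 'rV_(1 + n)))) => i.
under eq_fun do rewrite mxE; exact: mphi.
Qed.

(** Borel measurability, through the coordinates of a row vector. *)
Definition mfun_rV n (f : 'rV[R]_n -> \bar R) :=
  measurable_fun [set: Rpow R n] (fun y => f (Rpow_rV y)).

Lemma mfun_rV_comp d (T : measurableType d) n (f : 'rV[R]_n -> \bar R)
    (phi : T -> 'rV[R]_n) : mfun_rV f ->
  (forall i, measurable_fun setT (fun t => phi t 0 i : measurableTypeR R)) ->
  measurable_fun setT (f \o phi).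
Proof.
move=> mf mphi.
rewrite (_ : f \o phi = (f \o @Rpow_rV R n) \o (@rV_Rpow n \o phi)).
  by apply: measurableT_comp => //; exact: measurable_rV_Rpow.
by apply/funext => t /=; rewrite rV_RpowK.
Qed.

Definition mask_int n (a : 'I_n -> bool) (f : 'rV[R]_n -> \bar R) : \bar R :=
  (\int[mask_measure a]_y f (Rpow_rV y))%E.

Definition tail_mask n (a : 'I_n.+1 -> bool) : 'I_n -> bool :=
  fun i => a (lift ord0 i).

Section mask_int_S.
Variables (n : nat) (a : 'I_n.+1 -> bool) (f : 'rV[R]_n.+1 -> \bar R).
Hypotheses (f0 : forall x, (0 <= f x)%E) (mf : mfun_rV f).

Lemma mask_intS : mask_int a f =
  (\int[coord_measure (a ord0)]_x mask_int (tail_mask a) (f \o cons_mx x))%E.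
Proof. by rewrite /mask_int/= fubini_tonelli1. Qed.

Lemma mask_intS_swap : mask_int a f =
  mask_int (tail_mask a)
    (fun y => \int[coord_measure (a ord0)]_x f (cons_mx x y))%E.
Proof. by rewrite /mask_int/= fubini_tonelli2. Qed.
End mask_int_S.

Lemma mask_int_ge0 n (a : 'I_n -> bool) f :
  (forall x, (0 <= f x)%E) -> (0 <= mask_int a f)%E.
Proof. by move=> f0; apply: integral_ge0. Qed.

Lemma mask_int_le n (a : 'I_n -> bool) f g : mfun_rV f -> mfun_rV g ->
  (forall x, (0 <= f x)%E) -> (forall x, (f x <= g x)%E) ->
  (mask_int a f <= mask_int a g)%E.
Proof. by move=> mf mg f0 fg; apply: ge0_le_integral. Qed.

Lemma mask_intZ n (a : 'I_n -> bool) f (k : R) : mfun_rV f ->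
  (forall x, (0 <= f x)%E) -> 0 <= k ->
  mask_int a (fun x => k%:E * f x)%E = (k%:E * mask_int a f)%E.
Proof. by move=> mf f0 k0; rewrite /mask_int ge0_integralZl. Qed.

Lemma eq_mask_int n (a : 'I_n -> bool) f g : f =1 g ->
  mask_int a f = mask_int a g.
Proof. by move=> fg; congr mask_int; apply/funext. Qed.

Lemma measurable_mask_int d (T : measurableType d) n (a : 'I_n -> bool)
    (f : T -> 'rV[R]_n -> \bar R) :
  (forall t x, (0 <= f t x)%E) ->
  measurable_fun setT (fun z : T * Rpow R n => f z.1 (Rpow_rV z.2)) ->
  measurable_fun setT (fun t => mask_int a (f t)).
Proof.
move=> f0 mf.
exact: (@measurable_fun_fubini_tonelli_F _ _ _ _ _ (mask_measure a)
  (fun z : T * Rpow R n => f z.1 (Rpow_rV z.2))).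
Qed.

Lemma mask_int_coord_swap n b (a : 'I_n -> bool) (f : R -> 'rV[R]_n -> \bar R) :
  (forall t x, (0 <= f t x)%E) ->
  measurable_fun setT
    (fun z : measurableTypeR R * Rpow R n => f z.1 (Rpow_rV z.2)) ->
  (\int[coord_measure b]_x mask_int a (f x) =
   mask_int a (fun y => \int[coord_measure b]_x f x y))%E.
Proof.
move=> f0 mf.
exact: (@fubini_tonelli _ _ _ _ _ (coord_measure b) (mask_measure a)
  (fun z : measurableTypeR R * Rpow R n => f z.1 (Rpow_rV z.2))).
Qed.

Lemma mask_int0 (a : 'I_0 -> bool) f : mask_int a f = f 0.
Proof. by rewrite /mask_int/= integral_dirac//= diracT mul1e. Qed.

Lemma integral_coord_false (f : measurableTypeR R -> \bar R) :
  measurable_fun setT f -> (\int[coord_measure false]_x f x = f 0%R)%E.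
Proof. by move=> mf; rewrite /= integral_dirac// diracT mul1e. Qed.

End mask_measure.

(** * Linear change of variables *)


(** The measurability proof is an argument of the canonical instance of
   [pushforward], which unification cannot recover from the map. *)
Definition image_measure d1 d2 (T1 : measurableType d1)
    (T2 : measurableType d2) (R : realType) (mu : {measure set T1 -> \bar R})
    (phi : T1 -> T2) (mphi : measurable_fun setT phi) :
    {measure set T2 -> \bar R} :=
  measure_function_pushforward__canonical__measure_function_Measure mu mphi.

Section cov.
Variable R : realType.

Lemma measurable_affine d (T : measurableType d) n m (phi : T -> 'rV[R]_n)
    (A : 'M[R]_(n, m)) c :
  (forall i, measurable_fun setT (fun t => phi t 0 i : measurableTypeR R)) ->
  forall j, measurable_fun setT
    (fun t => (phi t *m A + c) 0 j : measurableTypeR R).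
Proof.
move=> mphi j; under eq_fun do rewrite !mxE.
apply: measurable_funD; last exact: measurable_cst.
apply: measurable_sum => i; apply: measurable_funM => //; exact: mphi.
Qed.

Lemma mfun_rV_affine n m (A : 'M[R]_(n, m)) c (f : 'rV[R]_m -> \bar R) :
  mfun_rV f -> mfun_rV (fun x => f (x *m A + c)).
Proof.
move=> mf; apply: (mfun_rV_comp (phi := fun y => Rpow_rV y *m A + c) mf).
by apply: measurable_affine => i; exact: measurable_coord.
Qed.

Lemma measurable_cons_mx d (T : measurableType d) n
    (x : T -> measurableTypeR R) (y : T -> 'rV[R]_n) :
  measurable_fun setT x ->
  (forall i, measurable_fun setT (fun t => y t 0 i : measurableTypeR R)) ->
  forall i, measurable_fun setT
    (fun t => cons_mx (x t) (y t) 0 i : measurableTypeR R).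
Proof.
move=> mx my i; case: (unliftP ord0 i) => [j ->|->].
  under eq_fun do rewrite cons_mxS.
  exact: my.
under eq_fun do rewrite cons_mx0.
exact: mx.
Qed.


Lemma measurable_affine_R (a b : R) :
  measurable_fun setT
    (fun x : measurableTypeR R => a * x + b : measurableTypeR R).
Proof. by apply: measurable_funD => //; apply: measurable_funM. Qed.

(** Both sides are measures of [A] and agree on half-open intervals, which
    determine a Borel measure on the line. *)
Lemma lebesgue_preimage_affine_pos (a b : R) (A : set (measurableTypeR R)) :
  0 < a -> measurable A ->
  (a%:E * lebesgue_measure ((fun x => a * x + b)%R @^-1` A) =
   lebesgue_measure A)%E.
Proof.
move=> a0 mA.
pose mu : {measure set (measurableTypeR R) -> \bar R} :=
  mscale (NngNum (ltW a0)) (image_measure (@lebesgue_measure R)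
    (measurable_affine_R a b)).
have -> // : lebesgue_measure A = mu A.
apply: lebesgue_measure_unique => // _ [[x y] _ <-] /=.
rewrite /mu/= /mscale/= /pushforward.
have -> : (fun x => a * x + b)%R @^-1` `]x, y]%classic = `](x - b) / a, (y - b) / a]%classic.
  apply/seteqP; split => z /=; rewrite !in_itv/= ltr_pdivrMr// ler_pdivlMr//;
  by rewrite ltrBlDr lerBrDr mulrC.
rewrite !lebesgue_measure_itv/= !lte_fin ltr_pM2r ?invr_gt0// ltrD2r.
case: ifP => _; last by rewrite mule0.
by rewrite -!EFinD -EFinM; congr EFin; field; rewrite gt_eqF.
Qed.

Lemma lebesgue_preimage_affine (a b : R) (A : set (measurableTypeR R)) :
  a != 0 -> measurable A ->
  (`|a|%:E * lebesgue_measure ((fun x => a * x + b)%R @^-1` A) =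
   lebesgue_measure A)%E.
Proof.
rewrite neq_lt => /orP[a0|a0] mA; last first.
  by rewrite gtr0_norm// lebesgue_preimage_affine_pos.
rewrite ltr0_norm// -(@lebesgue_preimage_affine_pos (- a) b A) ?oppr_gt0//.
congr (_ * _)%E; rewrite -[RHS]lebesgue_measureN.
  congr lebesgue_measure; apply/seteqP; split => x /=; by rewrite mulrNN.
rewrite -[X in measurable X]setTI.
exact: measurable_affine_R.
Qed.

Lemma integral_affine (a b : R) (f : R -> \bar R) : a != 0 ->
  measurable_fun [set: measurableTypeR R] f -> (forall x, 0 <= f x)%E ->
  (\int[lebesgue_measure]_x f (a * x + b)%R =
   `|a|^-1%:E * \int[lebesgue_measure]_x f x)%E.
Proof.
move=> a0 mf f0.
have pa : 0 < `|a| by rewrite normr_gt0.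
pose phi := (fun x : measurableTypeR R => a * x + b : measurableTypeR R).
pose mu : {measure set (measurableTypeR R) -> \bar R} :=
  mscale (NngNum (normr_ge0 a)) (image_measure (@lebesgue_measure R)
    (measurable_affine_R a b)).
have -> : (\int[lebesgue_measure]_x f x = \int[mu]_x f x)%E.
  apply: eq_measure_integral => A mA _.
  exact: (esym (lebesgue_preimage_affine b a0 mA)).
rewrite ge0_integral_mscale//= ge0_integral_pushforward//; last first.
  exact: measurable_affine_R.
by rewrite muleA -EFinM mulVf ?mul1e// gt_eqF.
Qed.

Definition leb_int n (f : 'rV[R]_n -> \bar R) := mask_int (fun=> true) f.

Lemma cons_mx_upper n (a : R) (u : 'rV[R]_n) (D : 'M[R]_n) (c0 : R) (c : 'rV_n) x y :
  cons_mx x y *m block_mx a%:M u 0 D + cons_mx c0 c =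
  cons_mx (a * x + c0) (y *m D + (x *: u + c)).
Proof.
rewrite [X in X + _](mul_row_block (const_mx x : 'rV_1)).
apply: etrans (add_row_mx _ _ _ _) _; rewrite mulmx0 addr0; congr row_mx.
  by apply/matrixP => i j; rewrite !ord1 !mxE big_ord1 !mxE/= mulr1n mulrC.
rewrite addrCA -addrA; congr (_ + (_ + _)).
by apply/rowP => i; rewrite !mxE big_ord1 !mxE.
Qed.

Lemma cons_mx_lower n (a : R) (v : 'cV[R]_n) (D : 'M[R]_n) (c0 : R) (c : 'rV_n) x y :
  cons_mx x y *m block_mx a%:M 0 v D + cons_mx c0 c =
  cons_mx (a * x + ((y *m v) 0 0 + c0)) (y *m D + c).
Proof.
rewrite [X in X + _](mul_row_block (const_mx x : 'rV_1)).
apply: etrans (add_row_mx _ _ _ _) _; rewrite mulmx0 add0r; congr row_mx.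
apply/matrixP => i j; rewrite !ord1 !mxE big_ord1 !mxE/= mulr1n mulrC.
by rewrite addrA.
Qed.

Lemma cons_mxK n (v : 'rV[R]_n.+1) :
  cons_mx (v 0 0) (rsubmx (v : 'rV_(1 + n))) = v.
Proof.
apply: etrans _ (@hsubmxK _ 1 1 n v); congr (row_mx _ _).
by apply/rowP => i; rewrite !mxE ord1; congr (v _ _); apply: ord_inj.
Qed.

Definition has_cov n (T : 'M[R]_n) := forall c (f : 'rV[R]_n -> \bar R),
  mfun_rV f -> (forall x, 0 <= f x)%E ->
  leb_int (fun x => f (x *m T + c)) = (`|\det T|^-1%:E * leb_int f)%E.

Lemma has_covM n (S T : 'M[R]_n) : has_cov S -> has_cov T -> has_cov (S *m T).
Proof.
move=> hS hT c f mf f0.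
under eq_fun do rewrite mulmxA -[_ *m S]addr0.
rewrite (hS 0 (fun x => f (x *m T + c)))//; last exact: mfun_rV_affine.
by rewrite hT// muleA -EFinM det_mulmx normrM invfM.
Qed.

Lemma mfun_rV_cons n (f : 'rV[R]_n.+1 -> \bar R) d (T : measurableType d)
    (x : T -> measurableTypeR R) (y : T -> 'rV[R]_n) : mfun_rV f ->
  measurable_fun setT x ->
  (forall i, measurable_fun setT (fun t => y t 0 i : measurableTypeR R)) ->
  measurable_fun setT (fun t => f (cons_mx (x t) (y t))).
Proof.
move=> mf mx my.
by apply: (mfun_rV_comp (phi := fun t => cons_mx (x t) (y t)) mf);
  exact: measurable_cons_mx.
Qed.

(** For fixed first coordinate, the map acts on the others as [D] followed by a
    translation. *)
Lemma has_cov_upper n a u (D : 'M[R]_n) : a != 0 -> has_cov D ->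
  has_cov (block_mx a%:M u 0 D : 'M[R]_(1 + n)).
Proof.
move=> a0 hD c f mf f0.
rewrite -(cons_mxK c); set c0 := c 0 0; set c' := rsubmx _.
have mfc x : mfun_rV (fun y => f (cons_mx x y)).
  by apply: mfun_rV_cons => //; exact: measurable_coord.
rewrite /leb_int mask_intS//; last exact: mfun_rV_affine.
transitivity (\int[lebesgue_measure]_x (`|\det D|^-1%:E *
    leb_int (f \o cons_mx (a * x + c0)))%E)%E.
  apply: eq_integral => x _; rewrite -(hD (x *: u + c') _ (mfc _) (fun=> f0 _)).
  by apply: eq_mask_int => y /=; rewrite cons_mx_upper.
have mi : measurable_fun setT
    (fun x : measurableTypeR R => leb_int (fun y => f (cons_mx x y))).
  by apply: measurable_mask_int => //; apply: mfun_rV_cons.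
rewrite ge0_integralZl//=; first last.
- by move=> x _; exact: (mask_int_ge0 _ (fun=> f0 _)).
- exact: (measurableT_comp mi (measurable_affine_R a c0)).
rewrite [X in (_ * X)%E](integral_affine c0 a0 mi
  (fun x => mask_int_ge0 _ (fun=> f0 _))).
rewrite muleA -EFinM mask_intS//; congr (_%:E * _)%E.
by rewrite (@det_ublock _ 1 n) det_scalar1 normrM invfM mulrC.
Qed.

(** For fixed last coordinates, the map acts on the first one as a homothety
    followed by a translation. *)
Lemma has_cov_lower n a v (D : 'M[R]_n) : a != 0 -> has_cov D ->
  has_cov (block_mx a%:M 0 v D : 'M[R]_(1 + n)).
Proof.
move=> a0 hD c f mf f0.
rewrite -(cons_mxK c); set c0 := c 0 0; set c' := rsubmx _.
have mfc y : measurable_fun [set: measurableTypeR R] (fun x => f (cons_mx x y)).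
  by apply: mfun_rV_cons.
have mz : measurable_fun setT (fun z : measurableTypeR R * Rpow R n =>
    f (cons_mx z.1 (Rpow_rV z.2))).
  apply: mfun_rV_cons => // i.
  exact: (measurableT_comp (measurable_coord i) (@measurable_snd _ _ _ _)).
have mi : mfun_rV (fun y => \int[lebesgue_measure]_x f (cons_mx x y))%E.
  exact: (@measurable_fun_fubini_tonelli_G _ _ _ _ _ (@lebesgue_measure R) _ mz).
have fi0 y : (0 <= \int[lebesgue_measure]_x f (cons_mx x y))%E.
  by apply: integral_ge0.
rewrite /leb_int mask_intS_swap//; last exact: mfun_rV_affine.
transitivity (leb_int (fun y => `|a|^-1%:E *
    \int[lebesgue_measure]_x f (cons_mx x (y *m D + c')))%E).
  apply: eq_mask_int => y.
  rewrite -(integral_affine ((y *m v) 0 0 + c0) a0 (mfc _))//.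
  by apply: eq_integral => x _; rewrite cons_mx_lower.
rewrite /leb_int mask_intZ//; last first.
  exact: (mfun_rV_affine _ _ mi).
rewrite [X in (_ * X)%E](hD c' _ mi fi0) muleA -EFinM mask_intS_swap//.
congr (_%:E * _)%E.
by rewrite (@det_lblock _ 1 n) det_scalar1 normrM invfM.
Qed.

Lemma has_cov1 n : has_cov (1%:M : 'M[R]_n).
Proof.
elim: n => [|n IH].
  move=> c f mf f0; rewrite /leb_int !mask_int0 det1 normr1 invr1 mul1e.
  by congr f; apply/rowP; case.
rewrite (_ : 1%:M = block_mx 1%:M 0 0 1%:M :> 'M[R]_(1 + n)).
  by apply: has_cov_upper => //; exact: oner_neq0.
by rewrite -scalar_mx_block.
Qed.

(** Block Gaussian elimination. A matrix with nonzero first entry is the product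
    of a lower and an upper block triangular matrix; adding to the first row a
    row with nonzero first entry, an upper triangular operation, brings the
    other invertible matrices to that form. *)
Lemma has_cov_unit n (T : 'M[R]_n) : T \in unitmx -> has_cov T.
Proof.
elim: n T => [T _|n IH T uT].
  by rewrite (_ : T = 1%:M) //; [exact: has_cov1 | apply/matrixP; case].
have pivot (T' : 'M[R]_(1 + n)) : T' \in unitmx -> T' 0 0 != 0 -> has_cov T'.
  move=> uT' T0.
  pose a := T' 0 0; pose u := ursubmx T'; pose v := dlsubmx T'.
  pose D := drsubmx T' - (a^-1 *: v) *m u.
  have TE : T' = block_mx 1%:M 0 (a^-1 *: v) 1%:M *m block_mx a%:M u 0 D.
    rewrite mulmx_block !mul1mx !mul0mx !addr0 mul_mx_scalar.
    rewrite scalerA mulfV// scale1r /D addrC subrK.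
    rewrite -[LHS](submxK (T' : 'M[R]_(1 + n, 1 + n))); congr block_mx.
    apply/matrixP => i j; rewrite !ord1 !mxE eqxx mulr1n.
    by congr (T' _ _); apply: ord_inj.
  have uD : D \in unitmx.
    move: uT'; rewrite TE unitmxE det_mulmx det_lblock !det1 !mul1r.
    by rewrite (@det_ublock _ 1 n) unitrM => /andP[].
  rewrite TE; apply: has_covM.
    by apply: has_cov_lower; [exact: oner_neq0 | exact: has_cov1].
  by apply: has_cov_upper; [|exact: IH].
have [T0|T0] := eqVneq (T 0 0) 0; last exact: (pivot T).
have [i Ti] : exists i : 'I_n, T (lift ord0 i) 0 != 0.
  apply: contrapT => /forallNP T00.
  have : T *m delta_mx 0 0 = 0 :> 'cV_n.+1.
    apply/colP => k; rewrite !mxE (bigD1 0)//= big1 => [|l /negPf l0].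
      rewrite !mxE eqxx mulr1 addr0; case: (unliftP ord0 k) => [l ->|->//].
      by apply/eqP/negPn/negP; exact: T00.
    by rewrite !mxE l0 mulr0.
  move/(congr1 (mulmx (invmx T))); rewrite mulKmx// mulmx0.
  by move/colP/(_ 0); rewrite !mxE !eqxx => /eqP; rewrite oner_eq0.
pose e : 'rV[R]_n := delta_mx 0 i.
have TE : T = (block_mx 1%:M (- e) 0 1%:M : 'M[R]_(1 + n)) *m
              ((block_mx 1%:M e 0 1%:M : 'M[R]_(1 + n)) *m T).
  rewrite mulmxA mulmx_block !mul1mx !mul0mx !mulmx0 !mulmx1 !addr0 !add0r.
  by rewrite subrr -scalar_mx_block mul1mx.
rewrite TE; apply: has_covM.
  by apply: has_cov_upper; [exact: oner_neq0 | exact: has_cov1].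
apply: pivot.
  by rewrite unitmx_mul uT andbT unitmxE (@det_ublock _ 1 n) !det1 mulr1 unitr1.
rewrite mxE big_ord_recl T0 mulr0 add0r.
have eE j : (block_mx 1%:M e 0 1%:M : 'M[R]_(1 + n)) 0 (lift ord0 j) = e 0 j.
  rewrite -[RHS](block_mxEur 1%:M e (0 : 'cV_n) 1%:M 0 j).
  by congr (fun_of_matrix (block_mx _ _ _ _) _ _); apply: ord_inj.
under eq_bigr => j _ do rewrite eE.
rewrite (bigD1 i)//= big1 ?addr0 => [|j /negPf ji]; last first.
  by rewrite mxE ji andbF mul0r.
by rewrite mxE !eqxx mul1r.
Qed.

Lemma leb_int_cov n (T : 'M[R]_n) c (f : 'rV[R]_n -> \bar R) :
  T \in unitmx -> mfun_rV f -> (forall x, 0 <= f x)%E ->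
  leb_int (fun x => f (x *m T + c)) = (`|\det T|^-1%:E * leb_int f)%E.
Proof. by move=> uT; exact: has_cov_unit. Qed.

(** * Integration over coordinate subspaces *)

(** Integration against a mask measure is Lebesgue integration over the
    coordinate subspace, which [E] parametrises isometrically. *)
Lemma mask_int_embed n (a : 'I_n -> bool) : exists k (E : 'M[R]_(k, n)),
  [/\ E *m E^T = 1%:M, E^T *m E = diag_mx (\row_i (a i)%:R) &
   forall f, mfun_rV f -> (forall x, 0 <= f x)%E ->
     mask_int a f = leb_int (fun s => f (s *m E))].
Proof.
elim: n a => [|n IH] a.
  exists 0, 0; split; [by apply/matrixP; case|by apply/matrixP; case|].
  move=> f mf f0; rewrite /leb_int !mask_int0; congr f.
  by apply/rowP; case.
have [k [E [EE DE intE]]] := IH (tail_mask a).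
have -> : (\row_i (a i)%:R) = cons_mx (a ord0)%:R (\row_i (tail_mask a i)%:R) :> 'rV[R]_n.+1.
  apply/rowP => i; rewrite mxE; case: (unliftP ord0 i) => [j ->|->].
    by rewrite cons_mxS mxE.
  by rewrite cons_mx0.
have diagE : diag_mx (cons_mx (a ord0)%:R (\row_i (tail_mask a i)%:R)) =
   block_mx (a ord0)%:R%:M 0 0 (E^T *m E) :> 'M[R]_(1 + n).
  rewrite DE; apply: etrans (diag_mx_row _ _) _; congr block_mx.
  by apply/matrixP => i j; rewrite !ord1 !mxE.
have mfc (f : 'rV[R]_n.+1 -> \bar R) : mfun_rV f -> forall x, mfun_rV (fun y => f (cons_mx x y)).
  move=> mf x; apply: (@mfun_rV_cons n f _ _ (fun=> x) (@Rpow_rV R n)) => //.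
  exact: measurable_coord.
rewrite diagE; case a0 : (a ord0).
- exists k.+1, (block_mx 1%:M 0 0 E : 'M[R]_(1 + k, 1 + n)); split.
  + rewrite (@tr_block_mx _ 1 k 1 n).
    apply: etrans (@mulmx_block _ 1 k 1 n 1 k _ _ _ _ _ _ _ _) _; rewrite !trmx0 !mul0mx ?mulmx0.
    by rewrite !addr0 !add0r EE trmx1 mulmx1 -scalar_mx_block.
  + rewrite (@tr_block_mx _ 1 k 1 n).
    apply: etrans (@mulmx_block _ 1 n 1 k 1 n _ _ _ _ _ _ _ _) _; rewrite !trmx0 !mul0mx ?mulmx0.
    by rewrite !addr0 !add0r trmx1 mulmx1.
  + move=> f mf f0; rewrite mask_intS// a0 /leb_int mask_intS//; last first.
      have := mfun_rV_affine (block_mx 1%:M 0 0 E : 'M[R]_(1 + k, 1 + n)) 0 mf.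
      by under eq_fun do rewrite addr0.
    apply: eq_integral => x _; rewrite (intE _ (mfc _ mf x) (fun=> f0 _)).
    apply: eq_mask_int => y /=; congr f.
    apply: etrans _ (esym (@mul_row_block _ 1 1 k 1 n _ _ _ _ _ _)).
    by rewrite !mulmx0 mulmx1 addr0 add0r.
- exists k, (row_mx 0 E : 'M[R]_(k, 1 + n)); split.
  + rewrite (@tr_row_mx _ k 1 n); apply: etrans (@mul_row_col _ k 1 n k _ _ _ _) _.
    by rewrite mul0mx add0r EE.
  + rewrite (@tr_row_mx _ k 1 n); apply: etrans (@mul_col_row _ 1 n k 1 n _ _ _ _) _.
    rewrite trmx0 !mul0mx mulmx0.
    by rewrite raddf0.
  + move=> f mf f0; rewrite mask_intS// a0.
    have mi : measurable_fun setT (fun x : measurableTypeR R =>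
        mask_int (tail_mask a) (fun y => f (cons_mx x y))).
      by apply: measurable_mask_int => //; apply: mfun_rV_cons.
    rewrite (integral_coord_false mi).
    rewrite (intE _ (mfc _ mf _) (fun=> f0 _)).
    apply: eq_mask_int => y /=; congr f.
    apply: etrans _ (esym (@mul_mx_row _ _ _ 1 n _ _ _)).
    by rewrite mulmx0.
Qed.

Lemma measurable_addrV d (T : measurableType d) n (x y : T -> 'rV[R]_n) :
  (forall i, measurable_fun setT (fun t => x t 0 i : measurableTypeR R)) ->
  (forall i, measurable_fun setT (fun t => y t 0 i : measurableTypeR R)) ->
  forall i, measurable_fun setT (fun t => (x t + y t) 0 i : measurableTypeR R).
Proof.
move=> mx my i; under eq_fun do rewrite mxE.
by apply: measurable_funD; [exact: mx | exact: my].
Qed.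

Lemma cons_mxD n (x x' : R) (y y' : 'rV[R]_n) :
  cons_mx x y + cons_mx x' y' = cons_mx (x + x') (y + y').
Proof.
apply: etrans (@add_row_mx _ 1 1 n _ _ _ _) _; congr (row_mx _ _).
by apply/matrixP => i j; rewrite !mxE.
Qed.

Lemma measurable_coord_fst d (T : measurableType d) n (i : 'I_n) :
  measurable_fun setT
    (fun z : Rpow R n * T => Rpow_rV z.1 0 i : measurableTypeR R).
Proof. exact: (measurableT_comp (measurable_coord i) (@measurable_fst _ _ _ _)). Qed.

Lemma measurable_coord_snd d (T : measurableType d) n (i : 'I_n) :
  measurable_fun setT
    (fun z : T * Rpow R n => Rpow_rV z.2 0 i : measurableTypeR R).
Proof. exact: (measurableT_comp (measurable_coord i) (@measurable_snd _ _ _ _)). Qed.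

Lemma mfun_rV_section n (f : 'rV[R]_n.+1 -> \bar R) x : mfun_rV f ->
  mfun_rV (fun y => f (cons_mx x y)).
Proof.
move=> mf; apply: (@mfun_rV_cons n f _ _ (fun=> x) (@Rpow_rV R n)) => //.
exact: measurable_coord.
Qed.

Lemma measurable_mask_int_section n (a : 'I_n -> bool)
    (f : 'rV[R]_n.+1 -> \bar R) : mfun_rV f -> (forall x, 0 <= f x)%E ->
  measurable_fun setT
    (fun x : measurableTypeR R => mask_int a (fun y => f (cons_mx x y))).
Proof. by move=> mf f0; apply: measurable_mask_int => //; apply: mfun_rV_cons. Qed.

(** Splitting the active coordinates into two groups is Tonelli's theorem,
    with the sum of two vectors in the role of the pair. *)
Lemma mask_int_conv n (a b c : 'I_n -> bool) (f : 'rV[R]_n -> \bar R) :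
  (forall i, c i = a i || b i) -> (forall i, ~~ (a i && b i)) ->
  mfun_rV f -> (forall x, 0 <= f x)%E ->
  mask_int c f = mask_int a (fun s => mask_int b (fun t => f (s + t))).
Proof.
elim: n a b c f => [|n IH] a b c f cab nab mf f0.
  by rewrite !mask_int0 addr0.
have mD : measurable_fun setT (fun z : Rpow R n.+1 * Rpow R n.+1 =>
    f (Rpow_rV z.1 + Rpow_rV z.2)).
  apply: (mfun_rV_comp (phi := fun z => _ + _) mf).
  by apply: measurable_addrV; [exact: measurable_coord_fst|exact: measurable_coord_snd].
have mDs s : mfun_rV (fun t => f (s + t)).
  apply: (mfun_rV_comp (phi := fun z => _ + _) mf).
  by apply: measurable_addrV => //; exact: measurable_coord.
pose F s := mask_int b (fun t => f (s + t)).
have F0 s : (0 <= F s)%E by exact: mask_int_ge0.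
have mF : mfun_rV F.
  exact: (@measurable_mask_int _ _ (Rpow R n.+1) _ b (fun s t => f (Rpow_rV s + t))).
have FE x s : F (cons_mx x s) = (\int[coord_measure R (b ord0)]_y
    mask_int (tail_mask b) (fun t => f (cons_mx (x + y) (s + t))))%E.
  rewrite /F (mask_intS _ (fun=> f0 _) (mDs _)).
  apply: eq_integral => y _.
  by apply: eq_mask_int => t /=; rewrite cons_mxD.
have mt x s : measurable_fun setT (fun y : measurableTypeR R =>
    mask_int (tail_mask b) (fun t => f (cons_mx (x + y) (s + t)))).
  have := measurable_mask_int_section (tail_mask b) (mDs (cons_mx x s)) (fun=> f0 _).
  by under eq_fun do under eq_mask_int do rewrite cons_mxD.
rewrite mask_intS// -/F [RHS]mask_intS//.
under eq_integral => x _ do rewrite (IH (tail_mask a) (tail_mask b) _ _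
  (fun i => cab _) (fun i => nab _) (mfun_rV_section x mf) (fun=> f0 _)).
have := nab ord0; rewrite cab; case a0 : (a ord0) => /= b0.
  apply: eq_integral => x _; apply: eq_mask_int => s /=.
  rewrite FE (negbTE b0) integral_coord_false//.
  by apply: eq_mask_int => t; rewrite addr0.
rewrite (integral_coord_false (measurable_mask_int_section _ mF F0)).
under [RHS]eq_mask_int do rewrite FE.
pose G (y : measurableTypeR R) (s : 'rV[R]_n) :=
  mask_int (tail_mask b) (fun t => f (cons_mx (0 + y) (s + t))).
have G0 y s : (0 <= G y s)%E by apply: mask_int_ge0.
have mG : measurable_fun setT
    (fun z : measurableTypeR R * Rpow R n => G z.1 (Rpow_rV z.2)).
  apply: (@measurable_mask_int _ _ (measurableTypeR R * Rpow R n)%type _ _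
    (fun z t => f (cons_mx (0 + z.1) (Rpow_rV z.2 + t)))) => //.
  apply: mfun_rV_cons => //=.
    under eq_fun do rewrite add0r.
    exact: (measurableT_comp (@measurable_fst _ _ _ _) (@measurable_fst _ _ _ _)).
  apply: measurable_addrV; last exact: measurable_coord_snd.
  move=> i; have := measurableT_comp
    (measurable_coord_snd (T := measurableTypeR R) i)
    (@measurable_fst _ _ (measurableTypeR R * Rpow R n)%type (Rpow R n)).
  exact.
apply: etrans _ (mask_int_coord_swap (b ord0) (tail_mask a) G0 mG).
apply: eq_integral => x _; apply: eq_mask_int => s.
by apply: eq_mask_int => t; rewrite add0r.
Qed.
End cov.

(** * Weighted means and the one-dimensional Brunn-Minkowski inequality *)


Section real_products.
Variable R : realType.
Implicit Types (I : finType).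

Lemma powR_prod I (P : pred I) (F : I -> R) (r : R) :
  (forall i, P i -> 0 <= F i) ->
  (\prod_(i | P i) F i) `^ r = \prod_(i | P i) F i `^ r.
Proof.
move=> F0; rewrite -(big_filter (index_enum I) P) -[RHS]big_filter.
have : forall i, i \in [seq i <- index_enum I | P i] -> 0 <= F i.
  by move=> i; rewrite mem_filter => /andP[/F0].
elim: ([seq i <- index_enum I | P i]) => [_|i s IH is0]; first by rewrite !big_nil powR1.
rewrite !big_cons powRM ?IH//.
- by move=> j js; apply: is0; rewrite inE js orbT.
- by apply: is0; rewrite inE eqxx.
- by rewrite big_seq prodr_ge0// => j js; apply: is0; rewrite inE js orbT.
Qed.

Lemma powR_sum I (P : pred I) (a : R) (F : I -> R) : 0 < a ->
  a `^ (\sum_(i | P i) F i) = \prod_(i | P i) a `^ F i.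
Proof.
move=> a0; elim/big_rec2: _ => [|i x y _ <-]; first by rewrite powRr0.
by rewrite powRD//; apply/implyP => _; rewrite gt_eqF.
Qed.

(** The weighted arithmetic-geometric mean inequality: the logarithm lies below
    its tangent at the arithmetic mean. *)
Lemma weighted_amgm I (P : pred I) (p a : I -> R) :
  (forall i, P i -> 0 <= p i) -> (forall i, P i -> 0 < a i) ->
  \sum_(i | P i) p i = 1 ->
  \prod_(i | P i) a i `^ p i <= \sum_(i | P i) p i * a i.
Proof.
move=> p0 a0 p1; set A := \sum_(i | P i) p i * a i.
have A0 : 0 < A.
  rewrite lt_neqAle sumr_ge0 ?andbT; last first.
    by move=> i Pi; rewrite mulr_ge0 ?p0// ltW ?a0.
  apply/eqP => /esym /psumr_eq0P pa.
  have : \sum_(i | P i) p i = 0.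
    rewrite big1// => i Pi; have /eqP := pa (fun i Pi => mulr_ge0 (p0 i Pi) (ltW (a0 i Pi))) i Pi.
    by rewrite mulf_eq0 [a i == 0]gt_eqF ?a0// orbF => /eqP.
  by rewrite p1 => /eqP; rewrite oner_eq0.
have -> : \prod_(i | P i) a i `^ p i = expR (\sum_(i | P i) p i * ln (a i)).
  rewrite expR_sum; apply: eq_bigr => i Pi.
  by rewrite /powR gt_eqF ?a0.
rewrite -[leRHS](lnK (x := A)) ?posrE// ler_expR.
have -> : ln A = \sum_(i | P i) p i * (a i / A - 1 + ln A).
  under eq_bigr do rewrite mulrDr mulrBr mulr1 mulrA.
  rewrite big_split/= sumrB -mulr_suml -/A p1 -mulr_suml p1 mul1r.
  by rewrite mulfV ?gt_eqF// subrr add0r.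
apply: ler_sum => i Pi; apply: ler_wpM2l; first exact: p0.
have aA : 0 < a i / A by rewrite divr_gt0// a0.
have := expR_ge1Dx (ln (a i / A)).
rewrite lnK ?posrE// ln_div ?posrE// ?a0//; lra.
Qed.
End real_products.

Section one_dim_brunn_minkowski.
Variable R : realType.
Local Notation lambda := (@lebesgue_measure R).
Local Notation mR := (measurableTypeR R).

Definition bounded_by (r : R) (A : set R) := forall x, A x -> `|x| <= r.

(** Translate [A] by a point of [B] near the infimum of [B], and [B] by a point
    of [A] near the supremum of [A]: both translates lie in the sumset, and they
    overlap in an interval of length at most [e]. *)
Lemma sumset_two (A B : set mR) r : measurable A -> measurable B ->
  A !=set0 -> B !=set0 -> bounded_by r A -> bounded_by r B ->
  forall e, 0 < e -> exists U : set mR, [/\ measurable U, U !=set0,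
    bounded_by (r + r) U, U `<=` [set x + y | x in A & y in B] &
    (lambda A + lambda B <= lambda U + e%:E)%E].
Proof.
move=> mA mB A0 B0 rA rB e e0.
have e2 : 0 < e / 2 by lra.
have supA : has_sup A.
  by split => //; exists r => x /rA; exact: le_trans (ler_norm _).
have infB : has_inf B.
  by split => //; exists (- r) => x /rB; rewrite ler_norml => /andP[].
have [a Aa aA] := sup_adherent e2 supA.
have [b Bb bB] := inf_adherent e2 infB.
pose X : set mR := (fun x => 1 * x + (- b)) @^-1` A.
pose Y : set mR := (fun x => 1 * x + (- a)) @^-1` B.
have mX : measurable X.
  by rewrite -[X]setTI; exact: (measurable_affine_R 1 (- b)).
have mY : measurable Y.
  by rewrite -[Y]setTI; exact: (measurable_affine_R 1 (- a)).
have lX : lambda A = lambda X.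
  by rewrite -(lebesgue_preimage_affine (- b) (oner_neq0 R) mA) normr1 mul1e.
have lY : lambda B = lambda Y.
  by rewrite -(lebesgue_preimage_affine (- a) (oner_neq0 R) mB) normr1 mul1e.
exists (X `|` Y); split.
- exact: measurableU.
- by exists (a + b); left; rewrite /X/= mul1r addrK.
- move=> x; rewrite /X /Y => -[] /=; rewrite mul1r => xr.
    rewrite -(subrK b x); apply: le_trans (ler_normD _ _) _.
    by apply: lerD; [exact: rA|exact: rB].
  rewrite -(subrK a x); apply: le_trans (ler_normD _ _) _.
  by apply: lerD; [exact: rB|exact: rA].
- move=> x; rewrite /X /Y => -[] /=; rewrite mul1r => xAB.
    by exists (x - b) => //; exists b => //; rewrite subrK.
  by exists a => //; exists (x - a) => //; rewrite addrC subrK.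
- rewrite lX lY.
  have XY : (lambda (X `&` Y) <= e%:E)%E.
    apply: (@le_trans _ _ (lambda `[inf B + a, sup A + b]%classic)).
      apply: le_measure; rewrite ?inE//; first exact: measurableI.
      move=> x; rewrite /X /Y => -[] /=; rewrite !mul1r in_itv/= => xA xB; apply/andP; split.
        by have := ge_inf infB.2 xB; rewrite lerBrDr.
      by have := ub_le_sup supA.2 xA; rewrite lerBlDr.
    rewrite lebesgue_measure_itv/=; case: ifP => _; last by rewrite lee_fin ltW.
    by rewrite -EFinD lee_fin; lra.
  rewrite (measureDI lambda mX mY).
  have -> : X `|` Y = (X `\` Y) `|` Y.
    apply/seteqP; split=> x; last by move=> [[]|]; [left|right].
    by move=> [Xx|]; [have [Yx|nYx] := pselect (Y x); [right|left]|right].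
  rewrite measureU//; last 2 first.
  - exact: measurableD.
  - by apply/seteqP; split => // x [[]].
  by rewrite -addeA [X in (_ + X <= _)%E]addeC addeA leeD2l.
Qed.

(** The one-dimensional Brunn-Minkowski inequality for finitely many bounded
    sets, approximated from inside by a measurable part of the sumset: sumsets
    of measurable sets need not be measurable. *)
Lemma sumset_family m (A : 'I_m -> set mR) (c : 'I_m -> R) r :
  (forall i, 0 <= c i) -> (forall i, measurable (A i)) ->
  (forall i, A i !=set0) -> (forall i, bounded_by r (A i)) ->
  forall e, 0 < e -> exists U : set mR, [/\ measurable U, U !=set0,
    exists r', bounded_by r' U,
    U `<=` [set y | exists2 x : 'I_m -> R, (forall i, A i (x i)) &
                                  y = \sum_(i < m) c i * x i] &
    (\sum_(i < m) (c i)%:E * lambda (A i) <= lambda U + e%:E)%E].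
Proof.
elim: m A c => [|m IH] A c c0 mA A0 rA e e0.
  exists [set 0]; split => //.
  - by exists 0.
  - by exists 0 => x ->; rewrite normr0.
  - by move=> _ ->; exists (fun=> 0); [case|rewrite big_ord0].
  - by rewrite big_ord0 adde_ge0// lee_fin ltW.
have e2 : 0 < e / 2 by lra.
have [U [mU U0 [s sU] UA leU]] := IH (fun i => A (lift ord0 i))
  (fun i => c (lift ord0 i)) (fun i => c0 _) (fun i => mA _) (fun i => A0 _)
  (fun i => rA _) _ e2.
pose glue (a : R) (x : 'I_m -> R) i := if unlift ord0 i is Some j then x j else a.
have glueP a x : A ord0 a -> (forall i, A (lift ord0 i) (x i)) ->
    (forall i, A i (glue a x i)) /\
    \sum_i c i * glue a x i = c ord0 * a + \sum_i c (lift ord0 i) * x i.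
  move=> Aa Ax; split.
    move=> i; rewrite /glue; case: (unliftP ord0 i) => [j ->|->] //.
  rewrite big_ord_recl /glue unlift_none; congr (_ + _).
  by apply: eq_bigr => i _; rewrite liftK.
have [a0 Aa0] := A0 ord0.
have [c00|c00] := eqVneq (c ord0) 0.
  exists U; split => //; first by exists s.
  - move=> y /UA[x Ax ->]; have [gA gE] := glueP a0 x Aa0 Ax.
    by exists (glue a0 x) => //; rewrite gE c00 mul0r add0r.
  - rewrite big_ord_recl c00 mul0e add0e (le_trans leU)// leeD2l// lee_fin; lra.
pose B : set mR := (fun x => (c ord0)^-1 * x + 0) @^-1` A ord0.
have c0V : (c ord0)^-1 != 0 by rewrite invr_eq0.
have cpos : 0 < c ord0 by rewrite lt_neqAle eq_sym c00 c0.
have mB : measurable B.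
  by rewrite -[B]setTI; exact: (measurable_affine_R (c ord0)^-1 0).
have lB : ((c ord0)%:E * lambda (A ord0) = lambda B)%E.
  rewrite -(lebesgue_preimage_affine 0 c0V (mA ord0)) muleA -EFinM.
  by rewrite gtr0_norm ?invr_gt0// mulfV// mul1e.
pose t := Num.max s (c ord0 * r).
have [|||V [mV V0 sV VBU leV]] := @sumset_two B U t mB mU _ U0 _ _ _ e2.
- by exists (c ord0 * a0); rewrite /B/= addr0 mulKf.
- move=> x; rewrite /B/= addr0 => /rA; rewrite normrM gtr0_norm ?invr_gt0//.
  by rewrite mulrC ler_pdivrMr// mulrC le_max => ->; rewrite orbT.
- by move=> x /sU; rewrite le_max => ->.
exists V; split => //; first by exists (t + t).
- move=> y /VBU[b Bb [_ /UA[x Ax ->] <-]].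
  have [gA gE] := glueP _ x Bb Ax.
  eexists; first exact: gA.
  by rewrite gE addr0 mulVKf.
- rewrite big_ord_recl lB.
  apply: (le_trans (leeD2l _ leU)); rewrite addeA (le_trans (leeD2r _ leV))//.
  by rewrite -addeA -EFinD leeD2l// lee_fin; lra.
Qed.

Lemma brunn_minkowski_1d m (A : 'I_m -> set mR) (c : 'I_m -> R) r (E : set mR) :
  (forall i, 0 <= c i) -> (forall i, measurable (A i)) ->
  (forall i, A i !=set0) -> (forall i, bounded_by r (A i)) ->
  measurable E ->
  (forall x : 'I_m -> R, (forall i, A i (x i)) -> E (\sum_(i < m) c i * x i)) ->
  (\sum_(i < m) (c i)%:E * lambda (A i) <= lambda E)%E.
Proof.
move=> c0 mA A0 rA mE AE; apply/lee_addgt0Pr => e e0.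
have [U [mU _ _ UA leU]] := sumset_family c0 mA A0 rA e0.
apply: (le_trans leU); rewrite leeD2r// le_measure ?inE//.
by move=> y /UA[x Ax ->]; exact: AE.
Qed.
End one_dim_brunn_minkowski.

(** * The one-dimensional Prékopa-Leindler inequality *)


Section prekopa_leindler_1d.
Variable R : realType.
Local Notation lambda := (@lebesgue_measure R).
Local Notation mR := (measurableTypeR R).

(** The restriction to positive heights makes the layer-cake formula an integral
    over the whole line. *)
Definition level_size (h : mR -> \bar R) (t : mR) : \bar R :=
  lambda [set x | (0 < t)%R /\ (t%:E < h x)%E].

Section layer_cake.
Variable h : mR -> \bar R.
Hypotheses (mh : measurable_fun setT h) (h0 : forall x, (0 <= h x)%E).

Let hypograph : set (mR * mR) := [set z | (0 < z.2)%R /\ (z.2%:E < h z.1)%E].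

Let measurable_hypograph : measurable hypograph.
Proof.
have m2 : measurable_fun setT (fun z : mR * mR => z.2%:E).
  by apply/measurable_EFinP; exact: measurable_snd.
have -> : hypograph = [set z : mR * mR | 0 < z.2%:E]%E `&` [set z | z.2%:E < h z.1]%E.
  by apply/seteqP; split => z; rewrite /hypograph/= lte_fin.
apply: measurableI; rewrite -[X in measurable X]setTI.
  exact: measurable_lte.
apply: measurable_lte => //.
exact: (measurableT_comp mh (@measurable_fst _ _ _ _)).
Qed.

Let level_sizeE : level_size h = lambda \o ysection hypograph.
Proof.
apply/funext => t /=; rewrite /level_size; congr (lambda _).
by apply/seteqP; split => x; rewrite /ysection/= inE.
Qed.

Lemma measurable_level_size : measurable_fun setT (level_size h).
Proof. by rewrite level_sizeE; exact: measurable_fun_ysection. Qed.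

Lemma measurable_level t : measurable [set x : mR | (0 < t)%R /\ (t%:E < h x)%E].
Proof.
have := measurable_ysection t measurable_hypograph.
congr measurable; apply/seteqP; split => x; by rewrite /ysection/= inE.
Qed.

(** Tonelli's theorem for the region under the graph. *)
Lemma layer_cake : (\int[lambda]_x h x = \int[lambda]_t level_size h t)%E.
Proof.
rewrite level_sizeE -(indic_fubini_tonelli_GE lambda measurable_hypograph).
rewrite -(indic_fubini_tonelli lambda lambda measurable_hypograph).
rewrite (indic_fubini_tonelli_FE lambda measurable_hypograph).
apply: eq_integral => x _ /=.
have -> : xsection hypograph x = [set t | (0 < t)%R /\ (t%:E < h x)%E].
  by apply/seteqP; split => t; rewrite /xsection/= inE.
have := h0 x; case: (h x) => [s|_|//]; last first.
  have -> : [set t : R | (0 < t)%R /\ (t%:E < +oo)%E] = `]0%R, +oo[%classic.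
    by apply/seteqP; split => t /=; rewrite in_itv/= andbT ltry// => -[].
  by rewrite lebesgue_measure_itv/= ltry.
rewrite lee_fin => s0.
have -> : [set t : R | (0 < t)%R /\ (t%:E < s%:E)%E] = `]0%R, s[%classic.
  by apply/seteqP; split => t /=; rewrite in_itv/= lte_fin => /andP.
rewrite lebesgue_measure_itv/= lte_fin; case: ltP => [|ss].
  by rewrite oppr0 adde0.
by congr EFin; apply/eqP; rewrite eq_le s0 ss.
Qed.
End layer_cake.

Lemma integral_bounded_support (f : mR -> R) (M r : R) : 0 <= r ->
  measurable_fun setT f -> (forall x, 0 <= f x <= M) ->
  (forall x, r < `|x| -> f x = 0) ->
  (\int[lambda]_x (f x)%:E <= (M * (r + r))%:E)%E.
Proof.
move=> r0 mf fM fr.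
have M0 : 0 <= M by have /andP[f0 f1] := fM 0; exact: le_trans f0 f1.
apply: (@le_trans _ _ (\int[lambda]_x (M%:E * (\1_(`[-r, r]%classic : set mR) x)%:E))%E).
  apply: ge0_le_integral => //=.
  - by move=> x _; rewrite lee_fin; case/andP: (fM x).
  - exact/measurable_EFinP.
  - by apply: measurable_funeM; exact/measurable_EFinP.
  - move=> x _; rewrite -EFinM lee_fin indicE.
    have [_|xr] := boolP (x \in _); first by rewrite mulr1; case/andP: (fM x).
    rewrite fr ?mulr0//; rewrite ltNge; apply: contra xr => xr.
    by rewrite inE/= in_itv/= -ler_norml.
rewrite ge0_integralZl//=; last first.
  exact/measurable_EFinP.
rewrite integral_indic//= setIT lebesgue_measure_itv/= lte_fin.
rewrite EFinM lee_wpmul2l ?lee_fin//; case: ifP => _.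
  by rewrite -EFinD opprK.
by rewrite lee_fin addr_ge0.
Qed.

Section prekopa_leindler.
Variables (m : nat) (act : 'I_m -> bool) (p th : 'I_m -> R).
Variables (f : 'I_m -> mR -> R) (h : mR -> \bar R) (c M r : R).
Hypotheses (c0 : 0 <= c) (p0 : forall j, 0 <= p j) (th0 : forall j, 0 <= th j).
Hypothesis p1 : \sum_(j | act j) p j = 1.
Hypotheses (r0 : 0 <= r)
  (mf : forall j, measurable_fun setT (f j))
  (fM : forall j x, 0 <= f j x <= M)
  (fr : forall j x, act j -> r < `|x| -> f j x = 0).
Hypotheses (mh : measurable_fun setT h) (h0 : forall x, (0 <= h x)%E).
Hypothesis fh : forall x : 'I_m -> R,
  ((c * \prod_(j | act j) f j (x j) `^ p j)%:E
   <= h (\sum_(j | act j) p j * th j * x j)%R)%E.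

Let I j := fine (\int[lambda]_x (f j x)%:E).
Let Q j := act j && (0 < p j).

Let I_ge0 j : 0 <= I j.
Proof.
by apply/fine_ge0/integral_ge0 => x _; rewrite lee_fin; case/andP: (fM j x).
Qed.

Let IE j : act j -> (\int[lambda]_x (f j x)%:E)%E = (I j)%:E.
Proof.
move=> aj; rewrite fineK// ge0_fin_numE.
  apply: le_lt_trans (integral_bounded_support r0 (mf j) (fM j) _) (ltry _).
  by move=> x; exact: fr.
by apply: integral_ge0 => x _; rewrite lee_fin; case/andP: (fM j x).
Qed.

Let prodQ (F : 'I_m -> R) :
  \prod_(j | act j) F j `^ p j = \prod_(j | Q j) F j `^ p j.
Proof.
rewrite [RHS]big_mkcondr; apply: eq_bigr => j _; case: ifPn => //.
by rewrite -leNgt => pj; rewrite (_ : p j = 0) ?powRr0//; apply/le_anti/andP.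
Qed.

Let sumQ (F : 'I_m -> R) :
  \sum_(j | act j) p j * F j = \sum_(j | Q j) p j * F j.
Proof.
rewrite [RHS]big_mkcondr; apply: eq_bigr => j _; case: ifPn => //.
by rewrite -leNgt => pj; rewrite (_ : p j = 0) ?mul0r//; apply/le_anti/andP.
Qed.

Let p1Q : \sum_(j | Q j) p j = 1.
Proof.
rewrite -p1 -[RHS](eq_bigr _ (fun j _ => mulr1 (p j))) sumQ.
by apply: eq_bigr => j _; rewrite mulr1.
Qed.

Let hasQ : exists j, Q j.
Proof.
apply: contrapT => /forallNP nQ.
have := p1Q; rewrite big1 => [/esym/eqP|j /nQ//].
by rewrite oner_eq0.
Qed.

Section nondegenerate.
Hypotheses (c_gt0 : 0 < c) (thI : forall j, Q j -> 0 < th j * I j).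

Let s j := sup (range (f j)).

Let f_sup j : has_sup (range (f j)).
Proof.
split; first by exists (f j 0); exists 0.
by exists M => _ [x _ <-]; case/andP: (fM j x).
Qed.

Let f_le_s j x : f j x <= s j.
Proof. by apply: (ub_le_sup (f_sup j).2); exists x. Qed.

Let s_gt0 j : Q j -> 0 < s j.
Proof.
move=> Qj; rewrite ltNge; apply/negP => sj.
have f0 x : f j x = 0.
  apply/le_anti/andP; split; first exact: le_trans (f_le_s j x) sj.
  by case/andP: (fM j x).
have := thI Qj; rewrite /I; under eq_integral do rewrite f0.
by rewrite integral0 mulr0 ltxx.
Qed.

Let ps j := p j * th j.

Let kappa := c * \prod_(j | Q j) s j `^ p j.

Let kappa_gt0 : 0 < kappa.
Proof.
rewrite /kappa mulr_gt0// prodr_gt0// => j Qj; rewrite powR_gt0//.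
exact: s_gt0.
Qed.

(** Heights are measured in units of the suprema [s j], so that the level sets
    of all the [f j] are nonempty for [t < 1] and empty for [1 <= t]. *)
Let level_le (t : R) :
  (\sum_(j | Q j) (ps j)%:E * level_size (EFin \o f j) (s j * t + 0)%R
   <= level_size h (kappa * t + 0)%R)%E.
Proof.
rewrite addr0; under eq_bigr do rewrite addr0.
have [t0|t0] := leP t 0.
  rewrite big1 ?measure_ge0// => j Qj; rewrite /level_size.
  rewrite (_ : mkset _ = set0) ?measure0 ?mule0//.
  apply/seteqP; split=> // x [+ _]; rewrite ltNge => /negP; apply.
  by rewrite mulr_ge0_le0// ltW// s_gt0.
have [t1|t1] := leP 1 t.
  rewrite big1 ?measure_ge0// => j Qj; rewrite /level_size.
  rewrite (_ : mkset _ = set0) ?measure0 ?mule0//.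
  apply/seteqP; split=> // x [_] /=; rewrite lte_fin ltNge => /negP; apply.
  by rewrite (le_trans (f_le_s j x))// ler_peMr// ltW// s_gt0.
pose A j : set mR := if Q j
  then [set x | (0 < s j * t)%R /\ ((s j * t)%R%:E < (f j x)%:E)%E] else [set 0].
pose C j := if Q j then ps j else 0.
have -> : (\sum_(j | Q j) (ps j)%:E * level_size (EFin \o f j) (s j * t)%R)%E =
          (\sum_j (C j)%:E * lambda (A j))%E.
  rewrite big_mkcond; apply: eq_bigr => j _; rewrite /C /A.
  by case: ifP => // _; rewrite mul0e.
apply: (brunn_minkowski_1d (r := r)).
- by move=> j; rewrite /C /ps; case: ifP => // _; rewrite mulr_ge0.
- move=> j; rewrite /A; case: ifP => // _.
  by apply: (@measurable_level (EFin \o f j)); exact/measurable_EFinP.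
- move=> j; rewrite /A; case: ifPn => [Qj|_]; last by exists 0.
  have [||_ [x _ <-] xs] := @sup_adherent _ (range (f j)) (s j - s j * t).
  + by rewrite subr_gt0 gtr_pMr// s_gt0.
  + exact: f_sup.
  + exists x; split; first by rewrite mulr_gt0// s_gt0.
    by rewrite lte_fin; move: xs; rewrite subKr.
- move=> j x; rewrite /A; case: ifPn => [Qj [st sx]|_ ->]; last by rewrite normr0.
  rewrite leNgt; apply/negP => xr.
  have aj : act j by case/andP: Qj.
  by move: sx; rewrite (fr aj xr) lte_fin ltNge ltW.
- exact: measurable_level.
- move=> x Ax; split; first by rewrite mulr_gt0.
  have -> : \sum_i C i * x i = \sum_(j | act j) p j * th j * x j.
    under [RHS]eq_bigr do rewrite -mulrA.
    rewrite sumQ [RHS]big_mkcond; apply: eq_bigr => j _; rewrite /C /ps.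
    by case: ifP => // _; rewrite ?mulrA ?mul0r.
  apply: lt_le_trans (fh x); rewrite lte_fin prodQ.
  have -> : kappa * t = c * \prod_(j | Q j) (s j * t) `^ p j.
    rewrite /kappa -mulrA; congr (_ * _).
    have tE : t = \prod_(j | Q j) t `^ p j by rewrite -powR_sum// p1Q powRr1// ltW.
    rewrite [X in _ * X = _]tE -big_split/=.
    by apply: eq_bigr => j Qj; rewrite powRM// ltW// s_gt0.
  rewrite ltr_pM2l//; apply: ltr_prod.
    by apply/hasP; have [j Qj] := hasQ; exists j => //; rewrite mem_index_enum.
  move=> j Qj; rewrite powR_ge0/=; have := Ax j; rewrite /A Qj => -[st sf].
  apply: gt0_ltr_powR; rewrite ?nnegrE.
  + by case/andP: Qj.
  + exact: ltW.
  + by case/andP: (fM j (x j)).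
  + by rewrite -lte_fin.
Qed.

Lemma prekopa_leindler_1d_nondegenerate :
  ((c * \prod_(j | act j) (th j * I j) `^ p j)%:E <= \int[lambda]_x h x)%E.
Proof.
pose D j := EFin \o f j.
have mD j : measurable_fun setT (D j) by exact/measurable_EFinP.
have D0 j x : (0 <= D j x)%E by rewrite lee_fin; case/andP: (fM j x).
have ls0 g t : (0 <= level_size g t)%E by exact: measure_ge0.
have Qact j : Q j -> act j by case/andP.
have int_le : (\sum_(j | Q j) (ps j)%:E * ((s j)^-1 * I j)%:E <=
    kappa^-1%:E * \int[lambda]_x h x)%E.
  rewrite (layer_cake mh h0) -{1}(gtr0_norm kappa_gt0).
  rewrite -(integral_affine 0 _ (measurable_level_size mh (h:=h)) (ls0 h)) ?gt_eqF//.
  have mls j : measurable_fun setT (fun t : mR => level_size (D j) (s j * t + 0)%R).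
    exact: (measurableT_comp (measurable_level_size (mD j)) (measurable_affine_R (s j) 0)).
  have ps0 j : 0 <= ps j by rewrite mulr_ge0.
  apply: (@le_trans _ _ (\int[lambda]_t
     \sum_(j | Q j) (ps j)%:E * level_size (D j) (s j * t + 0)%R)%E).
    under eq_integral do rewrite -big_filter.
    rewrite ge0_integral_sum//; first last.
    - by move=> j t _; rewrite mule_ge0// lee_fin.
    - by move=> j; exact: measurable_funeM.
    rewrite big_filter le_eqVlt; apply/orP; left; apply/eqP.
    apply: eq_bigr => j Qj; rewrite ge0_integralZl ?lee_fin//.
    rewrite (integral_affine 0 _ (measurable_level_size (mD j)) (ls0 _)); last first.
      by rewrite gt_eqF// s_gt0.
    rewrite -(layer_cake (mD j) (D0 j)) IE; last exact: Qact.
    by rewrite EFinM gtr0_norm// s_gt0.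
  apply: ge0_le_integral => //.
  - by move=> t _; apply: sume_ge0 => j _; rewrite mule_ge0// lee_fin.
  - under eq_fun do rewrite -big_filter.
    by apply: emeasurable_sum => j; exact: measurable_funeM.
  - exact: (measurableT_comp (measurable_level_size mh) (measurable_affine_R kappa 0)).
have {}int_le : ((kappa * \sum_(j | Q j) p j * (th j * I j / s j))%:E <=
    \int[lambda]_x h x)%E.
  rewrite EFinM -(@lee_pdivlMl _ kappa)//; apply: le_trans int_le.
  rewrite -sumEFin le_eqVlt; apply/orP; left; apply/eqP.
  by apply: eq_bigr => j Qj; rewrite -EFinM; congr EFin; rewrite /ps; ring.
apply: le_trans int_le; rewrite lee_fin prodQ /kappa -mulrA.
have -> : \prod_(j | Q j) (th j * I j) `^ p j =
    \prod_(j | Q j) s j `^ p j * \prod_(j | Q j) (th j * I j / s j) `^ p j.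
  rewrite -big_split/=; apply: eq_bigr => j Qj; have sj := s_gt0 Qj.
  rewrite -powRM ?ltW ?divr_gt0 ?thI//.
  by rewrite [s j * _]mulrC divfK// gt_eqF.
rewrite ler_wpM2l// ler_wpM2l//; first by apply: prodr_ge0 => j _; exact: powR_ge0.
by apply: weighted_amgm => // j Qj; rewrite divr_gt0 ?thI ?s_gt0.
Qed.
End nondegenerate.

(** Every superlevel set of [h] at a height proportional to [t] contains the
    weighted sumset of the superlevel sets of the [f j]; integrating the
    one-dimensional Brunn-Minkowski inequality over [t] and applying the
    arithmetic-geometric mean inequality gives the bound. *)
Lemma prekopa_leindler_1d :
  ((c * \prod_(j | act j) (th j * I j) `^ p j)%:E <= \int[lambda]_x h x)%E.
Proof.
have h_ge0 : (0 <= \int[lambda]_x h x)%E by exact: integral_ge0.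
have [c_eq0|c_neq0] := eqVneq c 0; first by rewrite c_eq0 mul0r.
have c_gt0 : 0 < c by rewrite lt_neqAle eq_sym c_neq0.
have [[j [Qj thIj]]|/forallNP thI] := pselect (exists j, Q j /\ th j * I j = 0).
  rewrite prodQ (bigD1 j)//= thIj powR0 ?mul0r ?mulr0//.
  by case/andP: Qj => _ /gt_eqF ->.
apply: prekopa_leindler_1d_nondegenerate => // j Qj; rewrite lt_neqAle mulr_ge0// andbT eq_sym.
by apply/eqP => thIj; apply: (thI j).
Qed.
End prekopa_leindler.
End prekopa_leindler_1d.

(** * The Prékopa-Leindler inequality for covers of the coordinates *)


Section box_prekopa_leindler.
Variable R : realType.
Local Notation lambda := (@lebesgue_measure R).
Local Notation mR := (measurableTypeR R).

(** A class of functions with finite integrals that is stable under integration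
    over one coordinate. The support is bounded in the integrated coordinates
    only. *)
Definition box_fun n (a : 'I_n -> bool) (M r : R) (f : 'rV[R]_n -> R) :=
  [/\ mfun_rV (EFin \o f), forall x, 0 <= f x <= M &
      forall (x : 'rV_n) i, a i -> r < `|x 0 i| -> f x = 0].

Lemma measurable_section_head n (f : 'rV[R]_n.+1 -> \bar R) y : mfun_rV f ->
  measurable_fun setT (fun x : mR => f (cons_mx x y)).
Proof. by move=> mf; apply: mfun_rV_cons. Qed.

Lemma measurable_coord_int n b (f : 'rV[R]_n.+1 -> \bar R) :
  mfun_rV f -> (forall x, 0 <= f x)%E ->
  mfun_rV (fun y => \int[coord_measure R b]_x f (cons_mx x y))%E.
Proof.
move=> mf f0.
apply: (@measurable_fun_fubini_tonelli_G _ _ _ _ _ (coord_measure R b)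
  (fun z : mR * Rpow R n => f (cons_mx z.1 (Rpow_rV z.2)))) => //.
Qed.

Section box_fun_tail.
Variables (n : nat) (a : 'I_n.+1 -> bool) (M r : R) (f : 'rV[R]_n.+1 -> R).
Hypotheses (r0 : 0 <= r) (bf : box_fun a M r f).

Let mf : mfun_rV (EFin \o f). Proof. by case: bf. Qed.
Let fM x : 0 <= f x <= M. Proof. by case: bf. Qed.
Let f0 x : (0 <= (EFin \o f) x)%E. Proof. by rewrite lee_fin; case/andP: (fM x). Qed.

Definition box_tail (y : 'rV[R]_n) : R :=
  fine (\int[coord_measure R (a ord0)]_x (f (cons_mx x y))%:E)%E.

Lemma box_tail_false y : a ord0 = false -> box_tail y = f (cons_mx 0 y).
Proof.
by move=> a0; rewrite /box_tail a0 integral_coord_false//; exact: (measurable_section_head _ mf).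
Qed.

Let int_le y : (\int[coord_measure R (a ord0)]_x (f (cons_mx x y))%:E
    <= (M * Num.max 1 (r + r))%:E)%E.
Proof.
have M0 : 0 <= M by have /andP[x0 xM] := fM 0; exact: le_trans x0 xM.
case a0 : (a ord0).
  apply: le_trans (integral_bounded_support (f := fun x => f (cons_mx x y)) r0 _ _ _) _.
  - by apply/measurable_EFinP; exact: (measurable_section_head _ mf).
  - by move=> x; exact: fM.
  - move=> x xr; case: bf => _ _ fr; apply: (fr _ ord0) => //.
    by rewrite cons_mx0.
  - by rewrite lee_fin ler_wpM2l// le_max lexx orbT.
rewrite integral_coord_false//; last exact: (measurable_section_head _ mf).
rewrite lee_fin; case/andP: (fM (cons_mx 0 y)) => _ /le_trans; apply.
by rewrite ler_peMr// le_max lexx.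
Qed.

Lemma box_tailE y :
  (box_tail y)%:E = (\int[coord_measure R (a ord0)]_x (f (cons_mx x y))%:E)%E.
Proof.
rewrite fineK// ge0_fin_numE; first exact: le_lt_trans (int_le y) (ltry _).
by apply: integral_ge0 => x _; exact: f0.
Qed.

Lemma box_fun_tail : box_fun (tail_mask a) (M * Num.max 1 (r + r)) r box_tail.
Proof.
split.
- suff -> : EFin \o box_tail = (fun y => \int[coord_measure R (a ord0)]_x
      (EFin \o f) (cons_mx x y))%E.
    exact: (measurable_coord_int (a ord0) mf f0).
  by apply/funext => y; exact: box_tailE.
- move=> y; rewrite fine_ge0 /=; last by apply: integral_ge0 => x _; exact: f0.
  by rewrite -lee_fin box_tailE.
- move=> y i ai ri; rewrite /box_tail.
  under eq_integral => x _.
    case: bf => _ _ fr; rewrite (fr _ (lift ord0 i))//; last first.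
      by rewrite cons_mxS.
    over.
  by rewrite integral0.
Qed.

Lemma mask_int_box_tail :
  mask_int a (EFin \o f) = mask_int (tail_mask a) (EFin \o box_tail).
Proof.
rewrite mask_intS_swap//; apply: eq_mask_int => y /=.
by rewrite box_tailE.
Qed.
End box_fun_tail.

Lemma sum_cons_mx n m (k x : 'I_m -> R) (y : 'I_m -> 'rV[R]_n) :
  \sum_j k j *: cons_mx (x j) (y j) = cons_mx (\sum_j k j * x j) (\sum_j k j *: y j).
Proof.
apply/rowP => i; rewrite summxE; case: (unliftP ord0 i) => [l ->|->].
  by rewrite cons_mxS summxE; apply: eq_bigr => j _; rewrite mxE cons_mxS [RHS]mxE.
by rewrite cons_mx0; apply: eq_bigr => j _; rewrite mxE cons_mx0.
Qed.

(** Each coordinate is handled by the one-dimensional inequality for the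
    functions that integrate over it; the others contribute a constant factor. *)
Theorem box_prekopa_leindler m (p th : 'I_m -> R) n (b : 'I_n -> bool)
    (a : 'I_m -> 'I_n -> bool) (f : 'I_m -> 'rV[R]_n -> R)
    (h : 'rV[R]_n -> \bar R) (c M r : R) :
  0 <= c -> (forall j, 0 <= p j) -> (forall j, 0 <= th j) -> 0 <= r ->
  (forall i, b i -> \sum_(j | a j i) p j = 1) ->
  (forall i j, ~~ b i -> ~~ a j i) ->
  (forall j, box_fun (a j) M r (f j)) -> mfun_rV h -> (forall x, 0 <= h x)%E ->
  (forall x : 'I_m -> 'rV[R]_n,
    ((c * \prod_j f j (x j) `^ p j)%:E <= h (\sum_j (p j * th j) *: x j)%R)%E) ->
  ((c * \prod_j (th j ^+ (\sum_i a j i)%N *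
      fine (mask_int (a j) (EFin \o f j))) `^ p j)%:E <= mask_int b h)%E.
Proof.
elim: n b a f h c M => [|n IH] b a f h c M c0 p0 th0 r0 ab nab bf mh h0 fh.
  rewrite mask_int0; have := fh (fun=> 0); rewrite [X in h X]big1 => [|j _]; last exact: scaler0.
  congr (_ <= _)%E; congr (_ * _)%:E; apply: eq_bigr => j _.
  by rewrite mask_int0 big_ord0 expr0 mul1r.
have fM j x : 0 <= f j x <= M by case: (bf j).
pose F j := box_tail (a j) (f j).
pose H y := (\int[coord_measure R (b ord0)]_x h (cons_mx x y))%E.
pose c' := c * \prod_(j | a j ord0) th j `^ p j.
have c'0 : 0 <= c' by rewrite mulr_ge0// prodr_ge0// => j _; exact: powR_ge0.
have FH y : ((c' * \prod_j F j (y j) `^ p j)%:E <=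
             H (\sum_j (p j * th j) *: y j)%R)%E.
  have mhY : measurable_fun setT
      (fun x : mR => h (cons_mx x (\sum_j (p j * th j) *: y j))).
    exact: measurable_section_head.
  rewrite /H; case b0 : (b ord0); last first.
    have a0 j : a j ord0 = false by apply/negbTE/nab; rewrite b0.
    rewrite integral_coord_false// /c' big_pred0// mulr1.
    have := fh (fun j => cons_mx 0 (y j)); rewrite sum_cons_mx.
    rewrite [X in cons_mx X _]big1 => [|j _]; last by rewrite mulr0.
    congr (_ <= _)%E; congr (_ * _)%:E; apply: eq_bigr => j _.
    by rewrite /F (box_tail_false (bf j)).
  have := @prekopa_leindler_1d R m (fun j => a j ord0) p th
    (fun j x => f j (cons_mx x (y j)))
    (fun x => h (cons_mx x (\sum_j (p j * th j) *: y j)%R))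
    (c * \prod_(j | ~~ a j ord0) f j (cons_mx 0 (y j)) `^ p j) M r.
  have -> : c * \prod_(j | ~~ a j ord0) f j (cons_mx 0 (y j)) `^ p j *
    \prod_(j | a j ord0) (th j * fine (\int[lambda]_x (f j (cons_mx x (y j)))%:E)%E) `^ p j
    = c' * \prod_j F j (y j) `^ p j.
    rewrite /c' -!mulrA; congr (_ * _).
    rewrite [X in _ = _ * X](bigID (fun j => a j ord0))/= mulrA -big_split/= mulrC.
    congr (_ * _).
      apply: eq_bigr => j aj; rewrite -powRM//; last first.
        by apply/fine_ge0/integral_ge0 => x _; rewrite lee_fin; case/andP: (fM j (cons_mx x (y j))).
      by rewrite /F /box_tail aj.
    apply: eq_bigr => j /negbTE aj; congr (_ `^ _).
    by rewrite /F (box_tail_false (bf j)).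
  apply => //.
  - by rewrite mulr_ge0// prodr_ge0// => j _; exact: powR_ge0.
  - exact: ab.
  - move=> j; apply/measurable_EFinP.
    by case: (bf j) => mfj _ _; exact: (measurable_section_head _ mfj).
  - move=> j x aj xr; case: (bf j) => _ _ fr; apply: (fr _ ord0) => //.
    by rewrite cons_mx0.
  - move=> x.
    have := fh (fun j => cons_mx (if a j ord0 then x j else 0) (y j)).
    rewrite sum_cons_mx; congr (_%:E <= h (cons_mx _ _))%E.
      rewrite [in LHS](bigID (fun j => a j ord0))/= -mulrA; congr (_ * _).
      rewrite mulrC; congr (_ * _); apply: eq_bigr => j.
        by move=> /negbTE ->.
      by move=> ->.
    rewrite [RHS]big_mkcond; apply: eq_bigr => j _.
    by case: ifP; rewrite ?mulr0.
have -> : c * \prod_j (th j ^+ (\sum_i a j i)%N *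
      fine (mask_int (a j) (EFin \o f j))) `^ p j =
    c' * \prod_j (th j ^+ (\sum_i tail_mask (a j) i)%N *
      fine (mask_int (tail_mask (a j)) (EFin \o F j))) `^ p j.
  rewrite /c' -mulrA; congr (_ * _).
  rewrite [X in _ = X * _]big_mkcond -big_split/=; apply: eq_bigr => j _.
  rewrite big_ord_recl exprD -mulrA (mask_int_box_tail r0 (bf j)).
  rewrite [LHS]powRM//; [|exact: exprn_ge0|]; last first.
    rewrite mulr_ge0 ?exprn_ge0//; apply/fine_ge0/integral_ge0 => x _.
    by rewrite lee_fin; case: (box_fun_tail r0 (bf j)) => _ /(_ (Rpow_rV x))/andP[].
  congr (_ * _); case: (a j ord0); first by rewrite expr1.
  by rewrite expr0 powR1.
rewrite (mask_intS_swap _ h0 mh).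
exact: (IH (tail_mask b) (fun j => tail_mask (a j)) F H c' _ c'0 p0 th0 r0
  (fun i => ab _) (fun i j => nab _ j) (fun j => box_fun_tail r0 (bf j))
  (measurable_coord_int _ mh h0) (fun y => integral_ge0 _ (fun x _ => h0 _)) FH).
Qed.
End box_prekopa_leindler.

(** * Gram determinants and Borel sets of row vectors *)


Section gram.
Variable R : realType.

(** Sylvester's identity: the two sides are the results of eliminating either
    diagonal block of one block matrix. *)
Lemma det_add1_mulC n k (X : 'M[R]_(k, n)) (Y : 'M[R]_(n, k)) :
  \det (1%:M + X *m Y) = \det (1%:M + Y *m X).
Proof.
have E1 : block_mx (1%:M + X *m Y) (- X) 0 1%:M *m block_mx 1%:M 0 Y 1%:M =
    block_mx 1%:M (- X) Y 1%:M.
  rewrite mulmx_block !mulmx1 ?mulmx0 ?mul1mx ?mul0mx ?add0r.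
  by rewrite mulNmx addrK.
have E2 : block_mx 1%:M 0 Y 1%:M *m block_mx 1%:M (- X) 0 (1%:M + Y *m X) =
    block_mx 1%:M (- X) Y 1%:M.
  rewrite mulmx_block ?mulmx1 ?mulmx0 ?mul1mx ?mul0mx ?addr0.
  by rewrite mulmxN addrC addrK.
have := congr1 determinant (etrans E1 (esym E2)).
by rewrite !det_mulmx !det_lblock !det_ublock !det1 !mulr1 !mul1r.
Qed.

Definition maskmx n (A : {set 'I_n}) : 'M[R]_n := diag_mx (\row_i (i \in A)%:R).

Lemma maskmxC n (A : {set 'I_n}) : maskmx (~: A) = 1%:M - maskmx A.
Proof.
apply/matrixP => i j; rewrite !mxE !inE; case: (i == j) => /=; last by rewrite !mulr0n subr0.
by rewrite !mulr1n; case: (i \in A); rewrite ?subrr ?subr0.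
Qed.

(** The Gram determinant of the rows of [V] indexed by [A], written as a
    determinant of full size so that no enumeration of [A] is needed. *)
Definition gram_det n (V : 'M[R]_n) (A : {set 'I_n}) : R :=
  \det (1%:M + (V *m V^T - 1%:M) *m maskmx A).

Definition gram_vol n (V : 'M[R]_n) (A : {set 'I_n}) : R :=
  Num.sqrt (gram_det V A).

(** Sylvester's identity moves the selection [E] of rows to the other side. *)
Lemma gram_detE n k (V : 'M[R]_n) (A : {set 'I_n}) (E : 'M[R]_(k, n)) :
  E *m E^T = 1%:M -> E^T *m E = maskmx A ->
  gram_det V A = \det ((E *m V) *m (E *m V)^T).
Proof.
move=> EE DE; rewrite /gram_det -DE mulmxA -det_add1_mulC.
rewrite mulmxBl mul1mx mulmxBr EE addrC subrK trmx_mul !mulmxA.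
by [].
Qed.

Lemma gram_detT n (V : 'M[R]_n) : gram_det V [set: 'I_n]%SET = \det V ^+ 2.
Proof.
rewrite /gram_det (_ : maskmx [set: 'I_n]%SET = 1%:M); last first.
  by apply/matrixP => i j; rewrite !mxE inE.
by rewrite mulmx1 addrC subrK det_mulmx det_tr expr2.
Qed.

(** Jacobi's identity between complementary minors of inverse matrices. *)
Lemma gram_det_dual n (V : 'M[R]_n) (A : {set 'I_n}) : V \in unitmx ->
  gram_det (invmx V)^T A = gram_det V (~: A) / \det V ^+ 2.
Proof.
move=> uV; set G := V *m V^T.
have uG : G \in unitmx by rewrite unitmx_mul uV unitmx_tr.
have GV : (invmx V)^T *m invmx V = invmx G.
  rewrite -[LHS](mulKmx uG) {2}/G -mulmxA [V^T *m _]mulmxA -trmx_mul mulVmx//.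
  by rewrite trmx1 mul1mx mulmxV// mulmx1.
have -> : gram_det (invmx V)^T A = \det (invmx G *m (G + (1%:M - G) *m maskmx A)).
  rewrite /gram_det mulmxDr mulVmx// mulmxA mulmxBr mulVmx// mulmx1.
  by rewrite trmxK GV.
rewrite det_mulmx det_inv /gram_det maskmxC -/G.
rewrite (_ : G + _ = 1%:M + (G - 1%:M) *m (1%:M - maskmx A)).
  by rewrite mulrC det_mulmx det_tr expr2.
rewrite mulmxBr mulmx1 [RHS]addrA (addrC 1%:M (G - _)) subrK.
by rewrite -mulNmx opprB.
Qed.

End gram.

(** * Borel sets of row vectors *)

Section measurable_rV.
Variable R : realType.

Definition measurable_rV n (B : set 'rV[R]_n) := measurable (@Rpow_rV R n @^-1` B).

Lemma mfun_rV_indic n (B : set 'rV[R]_n) : measurable_rV B ->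
  mfun_rV (fun x => (\1_B x)%:E).
Proof.
move=> mB; apply/measurable_EFinP.
exact: (measurable_indic (U := @Rpow_rV R n @^-1` B)).
Qed.

Lemma lebesgue_rVE n (B : set 'rV[R]_n) : measurable_rV B ->
  lebesgue_rV B = leb_int (fun x => (\1_B x)%:E).
Proof.
move=> mB; rewrite /lebesgue_rV mask_measureT /leb_int /mask_int.
by rewrite -(setIT (_ @^-1` B)) -integral_indic.
Qed.

Lemma measurable_rV_preim n m (A : 'M[R]_(n, m)) c (B : set 'rV[R]_m) :
  measurable_rV B -> measurable_rV [set x | B (x *m A + c)].
Proof.
move=> mB; rewrite /measurable_rV.
have mphi : measurable_fun setT (@rV_Rpow R m \o (fun y => @Rpow_rV R n y *m A + c)).
  by apply: measurable_rV_Rpow; apply: measurable_affine => i; exact: measurable_coord.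
have := mphi measurableT _ mB; rewrite setTI; congr measurable.
by apply/seteqP; split => y /=; rewrite rV_RpowK.
Qed.

Lemma measurable_rV_coord n (i : 'I_n) (C : set (measurableTypeR R)) :
  measurable C -> measurable_rV [set x : 'rV[R]_n | C (x 0 i)].
Proof.
by move=> mC; have := measurable_coord i measurableT mC; rewrite setTI.
Qed.

Lemma measurable_rV_bigcap n (I : finType) (B : I -> set 'rV[R]_n) :
  (forall i, measurable_rV (B i)) -> measurable_rV [set x | forall i, B i x].
Proof.
move=> mB; rewrite /measurable_rV.
rewrite (_ : _ @^-1` _ = \bigcap_(i in [set: I]) (@Rpow_rV R n @^-1` B i)).
  apply: fin_bigcap_measurable; first exact: finite_finset.
  by move=> i _; exact: mB.
by apply/seteqP; split => x /= Bx i; [move=> _|]; exact: Bx.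
Qed.

(** An open set is the union of the countably many rational boxes inside it. *)
Lemma open_measurable_rV n (O : set 'rV[R]_n) : open O -> measurable_rV O.
Proof.
move=> oO.
pose box (z : 'rV[rat]_n * rat) : set 'rV[R]_n :=
  [set y | forall i, `|y 0 i - ratr (z.1 0 i)| < ratr z.2].
have mbox z : measurable_rV (box z).
  apply: measurable_rV_bigcap => i.
  apply: (@measurable_rV_coord n i [set t | `|t - ratr (z.1 0 i)| < ratr z.2]).
  have -> : [set t : R | `|t - ratr (z.1 0 i)| < ratr z.2] =
      `]ratr (z.1 0 i) - ratr z.2, ratr (z.1 0 i) + ratr z.2[%classic.
    apply/seteqP; split => t /=; rewrite in_itv/= ltr_distl//.
  exact: measurable_itv.
have -> : O = \bigcup_(k : nat) (if unpickle k is Some z then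
    [set x | box z `<=` O /\ box z x] else set0).
  apply/seteqP; split=> x; last first.
    by move=> [k _]; case: (unpickle k) => // z [zO /zO].
  move=> Ox.
  have [e /= e0 xeO] : nbhs_ball x O by rewrite nbhs_ballE; exact: open_nbhs_nbhs.
  have [q q0 qe] : exists2 q : rat, 0 < ratr q :> R & ratr q < e / 2 :> R.
    have /rat_in_itvoo[q] : 0 < e / 2 by rewrite divr_gt0.
    by rewrite in_itv/= => /andP[q0 qe]; exists q.
  have /choice[y xy] : forall i, exists y : rat, `|x 0 i - ratr y| < ratr q.
    move=> i; have /rat_in_itvoo[y] : x 0 i - ratr q < x 0 i + ratr q by lra.
    rewrite in_itv/= => /andP[y1 y2]; exists y.
    by rewrite distrC ltr_distl y1 y2.
  pose z := (\row_i y i, q).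
  exists (pickle z) => //; rewrite pickleK; split; last by move=> i; rewrite mxE.
  move=> u zu; apply: xeO; split=> // i j; rewrite !ord1 /ball/=.
  have := zu j; have := xy j; rewrite mxE/= => a b.
  rewrite -(subrK (ratr (y j)) (x 0 j)) -addrA.
  apply: (le_lt_trans (ler_normD _ _)).
  rewrite (distrC (ratr (y j)) _); lra.
rewrite /measurable_rV preimage_bigcup; apply: bigcup_measurable => k _.
case: (unpickle k) => [z|]; last by rewrite preimage_set0.
have [zO|zO] := pselect (box z `<=` O); last first.
  rewrite (_ : _ @^-1` _ = set0)//; apply/seteqP; split => // x [].
  by [].
rewrite (_ : _ @^-1` _ = @Rpow_rV R n @^-1` box z); first exact: mbox.
by apply/seteqP; split => x /= => [[]|].
Qed.

Lemma closed_measurable_rV n (F : set 'rV[R]_n) : closed F -> measurable_rV F.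
Proof.
move=> cF; rewrite /measurable_rV -(setCK F) preimage_setC; apply: measurableC.
exact: (open_measurable_rV (closed_openC cF)).
Qed.
End measurable_rV.

(** * Volumes in coordinate subspaces *)


Section coord_space.
Variables (R : realType) (n : nat).
Implicit Types (V : 'M[R]_n) (A : {set 'I_n}) (F : {vspace 'rV[R]_n}).

Definition supported A (t : 'rV[R]_n) := forall i, i \notin A -> t 0 i = 0.

(** [F] is the span of the rows of [V] indexed by [A]. *)
Definition coord_space V A F :=
  forall u, u \in F <-> exists2 t, supported A t & u = t *m V.

Lemma mul_maskmx A (t : 'rV[R]_n) i : (t *m maskmx R A) 0 i = t 0 i * (i \in A)%:R.
Proof. by rewrite mul_mx_diag !mxE. Qed.

Lemma supported_maskmx A (t : 'rV[R]_n) : supported A t -> t *m maskmx R A = t.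
Proof.
move=> tA; apply/rowP => i; rewrite mul_maskmx.
by have [iA|iA] := boolP (i \in A); rewrite ?mulr1// tA ?mul0r.
Qed.

Lemma maskmx_embed_card A k (E : 'M[R]_(k, n)) :
  E *m E^T = 1%:M -> E^T *m E = maskmx R A -> k = #|A|.
Proof.
move=> EE DE; apply/eqP; rewrite -(eqr_nat R); apply/eqP.
rewrite -(mxtrace1 R k) -EE mxtrace_mulC DE mxtrace_diag.
rewrite -sum1_card natr_sum [RHS]big_mkcond; apply: eq_bigr => i _.
by rewrite mxE; case: (i \in A).
Qed.

Lemma mask_int_supported A f g : mfun_rV f -> mfun_rV g ->
  (forall t, 0 <= f t)%E -> (forall t, 0 <= g t)%E ->
  (forall t, supported A t -> f t = g t) ->
  mask_int (fun i => i \in A) f = mask_int (fun i => i \in A) g.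
Proof.
move=> mf mg f0 g0 fg.
have [k [E [EE DE intE]]] := mask_int_embed R (fun i : 'I_n => i \in A).
rewrite !intE//; apply: eq_mask_int => s; apply: fg => i iA.
rewrite -[E]mul1mx -EE -mulmxA DE mulmxA mul_maskmx.
by rewrite (negbTE iA) mulr0.
Qed.

Definition onbmx F : 'M[R]_(\dim F, n) := \matrix_i tnth (onb F) i.

Lemma onbmx_sum F (t : 'rV_(\dim F)) :
  t *m onbmx F = \sum_i t 0 i *: tnth (onb F) i.
Proof. by rewrite mulmx_sum_row; apply: eq_bigr => i _; rewrite rowK. Qed.

Lemma onbmxP F : onbmx F *m (onbmx F)^T = 1%:M.
Proof.
have [_ eij] := onbP F; apply/matrixP => i j.
rewrite !mxE -eij dotvE; apply: eq_bigr => l _; by rewrite !mxE.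
Qed.

Lemma onbmx_mem F (t : 'rV_(\dim F)) : t *m onbmx F \in F.
Proof.
have [bF _] := onbP F; rewrite onbmx_sum; apply: rpred_sum => i _.
by apply: memvZ; apply: (basis_mem bF); exact: mem_tnth.
Qed.

Lemma onbmxK F u : u \in F -> u *m (onbmx F)^T *m onbmx F = u.
Proof.
have [bF _] := onbP F => uF.
suff [t ->] : exists t, u = t *m onbmx F by rewrite -(mulmxA t) onbmxP mulmx1.
exists (\row_i coord (onb F) i u); rewrite onbmx_sum {1}(coord_basis bF uF).
by apply: eq_bigr => i _; rewrite mxE (tnth_nth 0).
Qed.

Section parametrization.
Variables (V : 'M[R]_n) (A : {set 'I_n}) (F : {vspace 'rV[R]_n}).
Hypotheses (uV : V \in unitmx) (FE : coord_space V A F).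
Variables (k : nat) (E : 'M[R]_(k, n)).
Hypotheses (EE : E *m E^T = 1%:M) (DE : E^T *m E = maskmx R A).

Let X := E *m V.

Let X_mem (s : 'rV_k) : s *m X \in F.
Proof.
apply/FE; exists (s *m E); last by rewrite mulmxA.
move=> i iA; rewrite -[E]mul1mx -EE -mulmxA DE mulmxA mul_maskmx.
by rewrite (negbTE iA) mulr0.
Qed.

Let X_surj u : u \in F -> exists s : 'rV_k, u = s *m X.
Proof.
move/FE => [t tA ->]; exists (t *m E^T).
by rewrite /X mulmxA -(mulmxA t) DE supported_maskmx.
Qed.

(** The selected rows of [V] and the orthonormal basis are two bases of [F]; [T]
    and [S] are the transition matrices. *)
Lemma coord_space_change : exists (T : 'M[R]_(k, \dim F)) (S : 'M[R]_(\dim F, k)),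
  [/\ E *m V = T *m onbmx F, T *m S = 1%:M & S *m T = 1%:M].
Proof.
pose T := X *m (onbmx F)^T.
have XT : X = T *m onbmx F.
  apply/row_matrixP => i; rewrite /T !row_mul.
  by rewrite onbmxK// -row_mul rowE X_mem.
have /choice[S OS] : forall i, exists s : 'rV_k, row i (onbmx F) = s *m X.
  by move=> i; apply: X_surj; rewrite rowE onbmx_mem.
have OE : onbmx F = (\matrix_i S i) *m X.
  by apply/row_matrixP => i; rewrite row_mul rowK OS.
exists T, (\matrix_i S i); split => //.
- have XR : X *m (invmx V *m E^T) = 1%:M.
    by rewrite /X mulmxA -(mulmxA E) mulmxV// mulmx1.
  by rewrite -[LHS]mulmx1 -XR mulmxA -(mulmxA T) -OE -XT.
- by rewrite -[LHS]mulmx1 -(onbmxP F) mulmxA -(mulmxA _ T) -XT -OE.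
Qed.

Lemma coord_space_dim_embed : k = \dim F.
Proof.
have [T [S [_ TS ST]]] := coord_space_change.
by apply/eqP; rewrite eqn_leq (mulmx1_min TS) (mulmx1_min ST).
Qed.
End parametrization.

Lemma coord_space_dim V A F : V \in unitmx -> coord_space V A F -> \dim F = #|A|.
Proof.
move=> uV FE.
have [k [E [EE DE _]]] := mask_int_embed R (fun i : 'I_n => i \in A).
by rewrite -(maskmx_embed_card EE DE) (coord_space_dim_embed uV FE EE DE).
Qed.

Lemma gram_vol_change V A F (E : 'M[R]_(\dim F, n)) (T : 'M[R]_(\dim F)) :
  E *m E^T = 1%:M -> E^T *m E = maskmx R A -> E *m V = T *m onbmx F ->
  gram_vol V A = `|\det T|.
Proof.
move=> EE DE XT.
rewrite /gram_vol (gram_detE V EE DE) XT trmx_mul mulmxA -(mulmxA T) onbmxP mulmx1.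
by rewrite det_mulmx det_tr -expr2 sqrtr_sqr.
Qed.

Lemma gram_vol_gt0 V A F : V \in unitmx -> coord_space V A F -> 0 < gram_vol V A.
Proof.
move=> uV FE.
have [k [E [EE DE _]]] := mask_int_embed R (fun i : 'I_n => i \in A).
have [T [S [XT TS ST]]] := coord_space_change uV FE EE DE.
have kF := coord_space_dim_embed uV FE EE DE.
subst k; rewrite (gram_vol_change EE DE XT) normr_gt0 -unitfE -unitmxE.
by have [] := mulmx1_unit TS.
Qed.

Definition section_fun V B (x t : 'rV[R]_n) : R := \1_B (x + t *m V).

Lemma mfun_section V B x : measurable_rV B ->
  mfun_rV (EFin \o section_fun V B x).
Proof.
move=> mB; have := mfun_rV_affine V x (mfun_rV_indic mB).
by rewrite /section_fun; under eq_fun do rewrite addrC.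
Qed.

(** The change of variables from the coordinates along the rows of [V] to the
    orthonormal coordinates that define [affine_vol]. *)
Lemma affine_vol_coord V A F x B : V \in unitmx -> coord_space V A F ->
  measurable_rV B ->
  affine_vol F x B = gram_vol V A *
    fine (mask_int (fun i => i \in A) (EFin \o section_fun V B x)).
Proof.
move=> uV FE mB.
have [k [E [EE DE intE]]] := mask_int_embed R (fun i : 'I_n => i \in A).
have [T [S [XT TS ST]]] := coord_space_change uV FE EE DE.
have kF := coord_space_dim_embed uV FE EE DE.
have b0 y : (0 <= (\1_B y : R)%:E)%E by rewrite lee_fin indicE.
subst k.
have uT : T \in unitmx by have [] := mulmx1_unit TS.
pose g (t : 'rV_(\dim F)) : \bar R := (\1_B (t *m onbmx F + x) : R)%:E.
have mg : mfun_rV g := mfun_rV_affine (onbmx F) x (mfun_rV_indic mB).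
have -> : affine_vol F x B = fine (leb_int g).
  rewrite /affine_vol.
  have -> : [set t : 'rV_(\dim F) | B (x + \sum_i t 0 i *: tnth (onb F) i)] =
      [set t | B (t *m onbmx F + x)].
    by apply/seteqP; split => t /=; rewrite onbmx_sum addrC.
  by rewrite (lebesgue_rVE (measurable_rV_preim (onbmx F) x mB)).
have -> : mask_int (fun i => i \in A) (EFin \o section_fun V B x) =
    leb_int (fun s => g (s *m T + 0)).
  rewrite intE; first last.
  - by move=> t; exact: b0.
  - exact: mfun_section.
  apply: eq_mask_int => s.
  by rewrite /g /= /section_fun addr0 -mulmxA XT mulmxA addrC.
rewrite (gram_vol_change EE DE XT).
have detT : `|\det T| != 0 by rewrite normr_eq0 -unitfE -unitmxE.
rewrite (leb_int_cov 0 uT mg); last by move=> t; exact: b0.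
have [gfin|] := boolP (leb_int g \is a fin_num).
  by rewrite -(fineK gfin) -EFinM /= mulrA mulfV ?mul1r.
rewrite ge0_fin_numE; last by apply: mask_int_ge0 => t; exact: b0.
rewrite -leNgt leye_eq => /eqP ->.
by rewrite gt0_muley ?mulr0// lte_fin invr_gt0 lt_neqAle eq_sym detT normr_ge0.
Qed.
End coord_space.

Section unit_box.
Variable R : realType.

Definition unit_box n (a : 'I_n -> bool) : set 'rV[R]_n :=
  [set t | forall i, 0 <= t 0 i <= (a i)%:R].

Lemma measurable_unit_box n (a : 'I_n -> bool) : measurable_rV (unit_box a).
Proof.
apply: (@measurable_rV_bigcap R n 'I_n (fun i t => 0 <= t 0 i <= (a i)%:R)) => i.
apply: (@measurable_rV_coord R n i [set x | 0 <= x <= (a i)%:R]).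
rewrite (_ : mkset _ = `[0, (a i)%:R]%classic); first exact: measurable_itv.
by apply/seteqP; split => x; rewrite /= in_itv.
Qed.

Lemma mask_int_unit_box n (a : 'I_n -> bool) :
  mask_int a (fun t => (\1_(unit_box a) t : R)%:E) = 1%E.
Proof.
elim: n a => [|n IH] a.
  by rewrite mask_int0 indicE mem_set//; case.
have u0 m (b : 'I_m -> bool) t : (0 <= (\1_(unit_box b) t : R)%:E)%E.
  by rewrite lee_fin indicE.
rewrite mask_intS//; last exact: mfun_rV_indic (measurable_unit_box a).
pose J : set (measurableTypeR R) := [set x | 0 <= x <= (a ord0)%:R].
have JE : J = `[0, (a ord0)%:R]%classic.
  by apply/seteqP; split => x; rewrite /J/= in_itv.
have mJ : measurable J by rewrite JE; exact: measurable_itv.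
transitivity (\int[coord_measure R (a ord0)]_x (\1_J x)%:E)%E.
  apply: eq_integral => x _.
  rewrite -[RHS]mule1 -(IH (tail_mask a)) -mask_intZ ?indicE//; last first.
    exact: mfun_rV_indic (measurable_unit_box _).
  apply: eq_mask_int => y /=; rewrite -EFinM !indicE -natrM mulnb.
  congr (_%:R%:E); congr nat_of_bool; apply/idP/andP.
    rewrite inE => xy; split; rewrite inE.
      by have := xy ord0; rewrite cons_mx0.
    by move=> i; have := xy (lift ord0 i); rewrite cons_mxS.
  rewrite !inE => -[xJ yB] i; case: (unliftP ord0 i) => [j ->|->].
    by rewrite cons_mxS.
  by rewrite cons_mx0.
rewrite integral_indic// setIT; case a0 : (a ord0).
  rewrite /= JE a0 lebesgue_measure_itv/= lte_fin ltr01.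
  by rewrite oppr0 adde0.
by rewrite /= diracE mem_set// /J/= a0 lexx.
Qed.
End unit_box.

Section families.
Variables (R : realType) (n : nat).
Implicit Types (w : 'I_n -> 'rV[R]_n) (A S : {set 'I_n}).

Definition rowsmx w : 'M[R]_n := \matrix_k w k.

Lemma mul_rowsmx (t : 'rV_n) w : t *m rowsmx w = \sum_k t 0 k *: w k.
Proof. by rewrite mulmx_sum_row; apply: eq_bigr => k _; rewrite rowK. Qed.

Lemma coord_space_spanv w A : coord_space (rowsmx w) A (spanv w A).
Proof.
move=> u; split=> [uA|[t tA ->]].
  pose G := limg (linfun (mulmxr (maskmx R A *m rowsmx w) : 'rV_n -> 'rV_n)).
  have : u \in G.
    move: u uA; apply/subvP/span_subvP => _ /mapP[k kA ->].
    apply/memv_imgP; exists (delta_mx 0 k); first exact: memvf.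
    rewrite lfunE/= mulmxA supported_maskmx.
      by rewrite -rowE rowK.
    by move=> i iA; rewrite mxE eqxx /=; case: eqP => // ik; move: iA; rewrite ik -mem_enum kA.
  move/memv_imgP => [t _]; rewrite lfunE/= => ->.
  exists (t *m maskmx R A); last by rewrite mulmxA.
  by move=> i iA; rewrite mul_maskmx (negbTE iA) mulr0.
rewrite mul_rowsmx; apply: rpred_sum => k _.
have [kA|/tA ->] := boolP (k \in A); last by rewrite scale0r mem0v.
by apply/memvZ/memv_span/map_f; rewrite mem_enum.
Qed.

Lemma basis_unitmx w : basis_of fullv [tuple w i | i < n] -> rowsmx w \in unitmx.
Proof.
move=> wb.
have /choice[Q QE] : forall i : 'I_n, exists t : 'rV[R]_n, delta_mx 0 i = t *m rowsmx w.
  move=> i; have : delta_mx 0 i \in spanv w [set: 'I_n]%SET.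
    have -> : spanv w [set: 'I_n]%SET = fullv.
      rewrite -(span_basis wb); congr span.
      by rewrite /image_mem enum_setT /= -enumT.
    exact: memvf.
  by move/coord_space_spanv => [t _ ->]; exists t.
suff : (\matrix_i Q i) *m rowsmx w = 1%:M by move/mulmx1_unit => [].
by apply/row_matrixP => i; rewrite row_mul rowK -QE row1.
Qed.

Lemma dim_spanv w A : rowsmx w \in unitmx -> \dim (spanv w A) = #|A|.
Proof. by move=> uw; exact: coord_space_dim uw (coord_space_spanv w A). Qed.

Lemma free_family w A : rowsmx w \in unitmx -> free [seq w k | k in A].
Proof. by move=> uw; rewrite /free size_image; apply/eqP; exact: dim_spanv. Qed.

(** The parallelepiped is the image of the unit cube. *)
Lemma wedge_volE w A : rowsmx w \in unitmx -> wedge_vol w A = gram_vol (rowsmx w) A.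
Proof.
move=> uw; rewrite /wedge_vol free_family//.
pose U : set 'rV[R]_n := unit_box (fun i : 'I_n => i \in A).
have PE : parallelepiped w A = [set u : 'rV[R]_n | U (u *m invmx (rowsmx w) + 0)].
  apply/seteqP; split => [_ [t t01 <-]|u Uu] /=.
    pose s : 'rV_n := \row_i (if i \in A then t i else 0).
    rewrite (_ : \sum_(k in A) _ = s *m rowsmx w); last first.
      rewrite mul_rowsmx big_mkcond; apply: eq_bigr => k _; rewrite mxE.
      by case: ifP => // _; rewrite scale0r.
    rewrite mulmxK// addr0 => i; rewrite mxE.
    by case: (i \in A); [exact: t01|rewrite lexx].
  pose t := u *m invmx (rowsmx w).
  have Ut : U t by rewrite /t -[X in U X]addr0.
  have t0 i : i \notin A -> t 0 i = 0.
    by move=> iA; apply/le_anti; have := Ut i; rewrite (negbTE iA) andbC.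
  exists (fun i => if i \in A then t 0 i else 0).
    by move=> i /=; case: ifPn => iA; [have := Ut i; rewrite iA|rewrite lexx ler01].
  rewrite -[RHS](mulmxKV uw) -/t mul_rowsmx big_mkcond; apply: eq_bigr => k _.
  by have [//|kA] := boolP (k \in A); rewrite t0// scale0r.
have mP : measurable_rV (parallelepiped w A).
  by rewrite PE; exact: measurable_rV_preim (measurable_unit_box R _).

rewrite (affine_vol_coord 0 uw (coord_space_spanv w A) mP).
rewrite (_ : mask_int _ _ = 1%E) ?mulr1// -(mask_int_unit_box R (fun i : 'I_n => i \in A)).
apply: eq_mask_int => t /=; rewrite /section_fun add0r PE; congr _%:E.
rewrite !indicE; congr (_%:R); congr nat_of_bool.
by apply/idP/idP; rewrite !inE/= mulmxK// addr0.
Qed.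
End families.

(** * The frame adapted to a subspace, and its dual *)


Section dot_products.
Variables (R : realType) (n : nat).
Implicit Types (v : 'I_n -> 'rV[R]_n).

Lemma dotv_mulmx (t x : 'rV_n) v :
  dotv (t *m rowsmx v) x = \sum_k t 0 k * dotv (v k) x.
Proof.
rewrite mul_rowsmx; elim/big_rec2: _ => [|k y1 y2 _ <-].
  by rewrite /dotv mul0mx mxE.
by rewrite dotvDl dotvZl.
Qed.

Lemma mulmx_rowsmxT (u : 'rV_n) v k : (u *m (rowsmx v)^T) 0 k = dotv u (v k).
Proof. by rewrite mxE dotvE; apply: eq_bigr => j _; rewrite !mxE. Qed.

Lemma gram_rowsmx v k l : (rowsmx v *m (rowsmx v)^T) k l = dotv (v k) (v l).
Proof. by rewrite mxE dotvE; apply: eq_bigr => j _; rewrite !mxE. Qed.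

Lemma orthv_spanvP v (A : {set 'I_n}) u :
  u \in orthv (spanv v A) <-> forall k, k \in A -> dotv u (v k) = 0.
Proof.
split=> [/orthvP uA k kA|uA].
  by apply/uA/memv_span/map_f; rewrite mem_enum.
apply/orthvP => x /coord_space_spanv[t tA ->].
rewrite dotvC dotv_mulmx big1// => k _; rewrite dotvC.
by have [/uA ->|/tA ->] := boolP (k \in A); rewrite ?mulr0 ?mul0r.
Qed.

Lemma dim_orthv (F : {vspace 'rV[R]_n}) : (n - \dim F <= \dim (orthv F))%N.
Proof.
rewrite /orthv; set f := linfun _.
have dimn m : \dim (fullv : {vspace 'rV[R]_m}) = m by rewrite dimvf /dim/= mul1n.
have E := limg_ker_dim f fullv; rewrite capfv dimn in E.
rewrite leq_subLR -[X in (X <= _)%N]E addnC leq_add2r.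
by apply: leq_trans (dimvS (subvf _)) _; rewrite dimn.
Qed.
End dot_products.

Section frame.
Variables (R : realType) (n : nat) (w : 'I_n -> 'rV[R]_n) (S : {set 'I_n}).
Hypothesis uw : rowsmx w \in unitmx.
Implicit Types A B : {set 'I_n}.

Let H := spanv w S.

(** The family [w] on [S], completed by an orthonormal family of the orthogonal
    complement: each subspace that cuts [K] in the statement is spanned by rows
    of this basis or of its dual. *)
Definition frame (k : 'I_n) : 'rV[R]_n :=
  if k \in S then w k else (onb (orthv H))`_(index k (enum (~: S))).

Let index_lt k : k \notin S -> (index k (enum (~: S)) < \dim (orthv H))%N.
Proof.
move=> kS; apply: leq_trans (dim_orthv H).
rewrite dim_spanv// (_ : (n - #|S|)%N = #|~: S|); last first.
  by rewrite [RHS]cardsCs finset.setCK card_ord.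
by rewrite cardE index_mem mem_enum inE.
Qed.

Lemma frame_orth k : k \notin S -> frame k \in orthv H.
Proof.
move=> kS; have [ob _] := onbP (orthv H).
rewrite /frame (negbTE kS) (basis_mem ob)// mem_nth// size_tuple.
exact: index_lt.
Qed.

Lemma frame_dot k l : k \notin S -> dotv (frame k) (frame l) = (k == l)%:R.
Proof.
move=> kS; have [lS|lS] := boolP (l \in S).
  have /orthv_spanvP/(_ l lS) := frame_orth kS.
  rewrite /frame lS => ->; case: eqP => // kl.
  by move: kS; rewrite kl lS.
have [_ odot] := onbP (orthv H).
rewrite /frame (negbTE kS) (negbTE lS).
have := odot (Ordinal (index_lt kS)) (Ordinal (index_lt lS)).
rewrite !(tnth_nth 0)/= => ->; congr (_%:R); congr nat_of_bool.
apply/eqP/eqP => [/(congr1 val)/= kl|kl]; last by apply: val_inj; rewrite /= kl.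
rewrite -(nth_index k (_ : k \in enum (~: S))) ?mem_enum ?inE// kl.
by rewrite nth_index// mem_enum inE.
Qed.

Let V := rowsmx frame.

Lemma frame_dotC k l : l \notin S -> dotv (frame k) (frame l) = (k == l)%:R.
Proof. by move=> lS; rewrite dotvC frame_dot// eq_sym. Qed.

Lemma frame_supported t A : A \subset S -> supported A t -> t *m V = t *m rowsmx w.
Proof.
move=> AS tA; rewrite !mul_rowsmx; apply: eq_bigr => k _.
have [kA|/tA ->] := boolP (k \in A); last by rewrite !scale0r.
by rewrite /frame (fintype.subsetP AS).
Qed.

Lemma frame_unit : V \in unitmx.
Proof.
rewrite -row_free_unit -kermx_eq0; apply/eqP/row_matrixP => i; rewrite row0.
set t := row i _.
have tV : t *m V = 0 by rewrite /t -row_mul mulmx_ker row0.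
have tS : supported S t.
  move=> l lS; have : dotv (t *m V) (frame l) = 0 by rewrite tV /dotv mul0mx mxE.
  rewrite dotv_mulmx (bigD1 l)//= frame_dotC// eqxx mulr1 big1 ?addr0// => k kl.
  by rewrite frame_dotC// (negbTE kl) mulr0.
by rewrite -(mulmxK uw t) -(frame_supported (subxx S) tS) tV mul0mx.
Qed.

Lemma frame_spanv A : A \subset S -> coord_space V A (spanv w A).
Proof.
move=> AS u; split=> [/coord_space_spanv|] [t tA ->].
  by exists t => //; rewrite (frame_supported AS).
by rewrite (frame_supported AS)//; apply/coord_space_spanv; exists t.
Qed.

Lemma supportedD A B (s t : 'rV[R]_n) :
  supported A s -> supported B t -> supported (A :|: B) (s + t).
Proof.
by move=> sA tB i; rewrite inE negb_or => /andP[/sA + /tB]; rewrite mxE => -> ->; rewrite addr0.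
Qed.

(** The part of a vector of the orthogonal complement carried by the rows in [S]
    belongs to [H] and is orthogonal to [H]. *)
Lemma frame_orthv : coord_space V (~: S) (orthv H).
Proof.
move=> u; split=> [uH|[t tS ->]]; last first.
  rewrite mul_rowsmx; apply: rpred_sum => k _.
  have [kS|kS] := boolP (k \in S); last by rewrite memvZ// frame_orth.
  by rewrite tS ?inE ?kS// scale0r mem0v.
pose t := u *m invmx V; have uE : u = t *m V by rewrite mulmxKV// frame_unit.
exists t => // k; rewrite inE negbK => kS.
pose s := t *m maskmx R S; pose s' := t *m maskmx R (~: S).
have sS : supported S s by move=> i iS; rewrite mul_maskmx (negbTE iS) mulr0.
have s'S : supported (~: S) s'.
  by move=> i; rewrite inE negbK => iS; rewrite mul_maskmx inE iS mulr0.
have tE : t = s + s' by rewrite /s /s' maskmxC mulmxBr mulmx1 addrC subrK.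
have s'H : s' *m V \in orthv H.
  rewrite mul_rowsmx; apply: rpred_sum => i _.
  have [iS|iS] := boolP (i \in S); last by rewrite memvZ// frame_orth.
  by rewrite s'S ?inE ?iS// scale0r mem0v.
have sVH : s *m V \in H by apply/(frame_spanv (subxx S)); exists s.
have sVo : s *m V \in orthv H.
  by rewrite (_ : s *m V = u - s' *m V) ?rpredB// uE tE mulmxDl addrK.
have : s *m V = 0 by apply/eqP; rewrite -dotv_eq0; apply/eqP; move/orthvP: sVo; exact.
move/(congr1 (mulmx^~ (invmx V))); rewrite mulmxK ?frame_unit// mul0mx => s0.
have : s 0 k = 0 by rewrite s0 mxE.
by rewrite mul_maskmx kS mulr1.
Qed.

Lemma frame_addv A : A \subset S ->
  coord_space V (A :|: ~: S) (spanv w A + orthv H)%VS.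
Proof.
move=> AS u; split.
  move=> /memv_addP[x /(frame_spanv AS)[s sA ->] [y /frame_orthv[t tS ->] ->]].
  by exists (s + t); [exact: supportedD|rewrite mulmxDl].
move=> [t tA ->].
have -> : t = t *m maskmx R A + t *m maskmx R (~: S).
  apply/rowP => i; rewrite mxE !mul_maskmx inE.
  have [iA|iA] := boolP (i \in A).
    by rewrite (fintype.subsetP AS _ iA) mulr1 mulr0 addr0.
  rewrite mulr0 add0r; have [iS|iS] := boolP (i \in S); last by rewrite mulr1.
  by rewrite mulr0 tA// !inE iS orbF.
rewrite mulmxDl memv_add//.
  by apply/(frame_spanv AS); eexists; last by []; move=> i iA; rewrite mul_maskmx (negbTE iA) mulr0.
by apply/frame_orthv; eexists; last by []; move=> i iA; rewrite mul_maskmx (negbTE iA) mulr0.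
Qed.

(** The biorthogonal family: orthogonality to rows of the frame means that the
    corresponding coordinates in this family vanish. *)
Definition dual_frame : 'M[R]_n := (invmx V)^T.

Lemma dual_frame_unit : dual_frame \in unitmx.
Proof. by rewrite unitmx_tr unitmx_inv frame_unit. Qed.

Lemma dual_frame_orthv A : A \subset S ->
  coord_space dual_frame (~: A) (orthv (spanv w A)).
Proof.
move=> AS u.
have VV : V^T *m dual_frame = 1%:M.
  by rewrite -trmx_mul mulVmx ?trmx1// frame_unit.
have VV' : dual_frame *m V^T = 1%:M.
  by rewrite /dual_frame -trmx_mul mulmxV ?trmx1// frame_unit.
have tk (t : 'rV_n) k : k \in A -> dotv (t *m dual_frame) (w k) = t 0 k.
  move=> kA; have -> : w k = frame k by rewrite /frame (fintype.subsetP AS _ kA).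
  by rewrite -mulmx_rowsmxT -mulmxA -/V VV' mulmx1.
split=> [/orthv_spanvP uA|[t tA ->]].
  have uE : u = u *m V^T *m dual_frame by rewrite -mulmxA VV mulmx1.
  exists (u *m V^T) => // k; rewrite inE negbK => kA.
  by rewrite -(tk _ k kA) -uE uA.
by apply/orthv_spanvP => k kA; rewrite tk// tA// inE kA.
Qed.

(** The completing rows are orthonormal and orthogonal to the others. *)
Lemma frame_gram_setU A : gram_det V (A :|: ~: S) = gram_det V A.
Proof.
rewrite /gram_det; congr (\det (_ + _)); apply/matrixP => k l.
rewrite !mul_mx_diag mxE [RHS]mxE; have [lS|lS] := boolP (l \in S).
  by congr (_ * _); rewrite !mxE !inE lS orbF.
suff -> : (V *m V^T - 1%:M) k l = 0 by rewrite !mul0r.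
by rewrite mxE gram_rowsmx frame_dotC// !mxE subrr.
Qed.

Lemma frame_gram A : A \subset S -> gram_det V A = gram_det (rowsmx w) A.
Proof.
move=> AS; have [k [E [EE DE _]]] := mask_int_embed R (fun i : 'I_n => i \in A).
rewrite !(gram_detE _ EE DE).
suff -> : E *m V = E *m rowsmx w by [].
rewrite -[E]mul1mx -EE -(mulmxA E) DE -!mulmxA; congr (E *m _).
apply/row_matrixP => i; rewrite !row_mul (frame_supported AS)// => j jA.
by rewrite rowE mul_maskmx (negbTE jA) mulr0.
Qed.

Lemma gram_det_set0 (U : 'M[R]_n) : gram_det U finset.set0 = 1.
Proof.
rewrite /gram_det (_ : maskmx R finset.set0 = 0) ?mulmx0 ?addr0 ?det1//.
by apply/matrixP => i j; rewrite !mxE inE mul0rn.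
Qed.

Lemma frame_gram_vol A : A \subset S ->
  gram_vol V (A :|: ~: S) = wedge_vol w A.
Proof.
by move=> AS; rewrite wedge_volE// /gram_vol frame_gram_setU frame_gram.
Qed.

Lemma frame_gram_volC : gram_vol V (~: S) = 1.
Proof.
rewrite -[~: S]finset.set0U /gram_vol frame_gram_setU gram_det_set0.
by rewrite sqrtr1.
Qed.

Lemma frame_det : `|\det V| = wedge_vol w S.
Proof.
rewrite -(frame_gram_vol (subxx S)) (_ : S :|: ~: S = [set: 'I_n]%SET); last first.
  by rewrite finset.setUCr.
by rewrite /gram_vol gram_detT sqrtr_sqr.
Qed.

Lemma frame_gram_volT : gram_vol V [set: 'I_n]%SET = wedge_vol w S.
Proof. by rewrite -frame_det /gram_vol gram_detT sqrtr_sqr. Qed.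

(** Jacobi's identity, with the determinant of the frame as total volume. *)
Lemma dual_frame_gram_vol A : A \subset S ->
  gram_vol dual_frame (~: A) = wedge_vol w A / wedge_vol w S.
Proof.
move=> AS; rewrite -frame_det -(frame_gram_vol AS) /gram_vol frame_gram_setU.
rewrite gram_det_dual ?frame_unit// finset.setCK.
by rewrite mulrC sqrtrM ?invr_ge0 ?sqr_ge0// sqrtrV ?sqr_ge0// sqrtr_sqr mulrC.
Qed.

Lemma dual_frame_gram_volT : gram_vol dual_frame [set: 'I_n]%SET = (wedge_vol w S)^-1.
Proof. by rewrite -frame_det /gram_vol gram_detT sqrtr_sqr det_tr det_inv normfV. Qed.
End frame.

(** * Sections of a convex set *)


Section convex_combinations.
Variables (R : realType) (n : nat) (K : set 'rV[R]_n).
Hypothesis cK : convex_set K.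

Lemma convex_set2 (t : R) x y : 0 <= t <= 1 -> K x -> K y ->
  K (t *: x + (1 - t) *: y).
Proof.
move=> /andP[t0 t1] Kx Ky.
have := cK (Itv01 t0 t1) (mem_set Kx) (mem_set Ky); rewrite inE.
by congr K.
Qed.

Lemma convex_set_sum m (lam : 'I_m -> R) (x : 'I_m -> 'rV[R]_n) :
  (forall j, 0 <= lam j) -> \sum_j lam j = 1 ->
  (forall j, 0 < lam j -> K (x j)) -> K (\sum_j lam j *: x j).
Proof.
elim: m lam x => [|m IH] lam x l0 l1 Kx.
  by move: l1; rewrite big_ord0 => /esym/eqP; rewrite oner_eq0.
rewrite big_ord_recl; move: l1; rewrite big_ord_recl.
set s := \sum_i _ => l1.
have s0 : 0 <= s by apply: sumr_ge0.
have [s_eq0|s_neq0] := eqVneq s 0.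
  rewrite big1 ?addr0 => [|i _].
    have l01 : lam ord0 = 1 by move: l1; rewrite s_eq0 addr0.
    by rewrite l01 scale1r; apply: Kx; rewrite l01.
  have /psumr_eq0P := s_eq0; move=> -> //; by rewrite scale0r.
have spos : 0 < s by rewrite lt_neqAle eq_sym s_neq0.
pose y := \sum_i (lam (lift ord0 i) / s) *: x (lift ord0 i).
have Ky : K y.
  apply: IH => [j||j]; first by rewrite divr_ge0.
    by rewrite -mulr_suml mulfV.
  by move=> lj; apply: Kx; rewrite -(pmulr_lgt0 _ (_ : 0 < s^-1)) ?invr_gt0.
have -> : \sum_i lam (lift ord0 i) *: x (lift ord0 i) = (1 - lam ord0) *: y.
  rewrite (_ : 1 - lam ord0 = s); last by rewrite -l1 addrC addKr.
  rewrite scaler_sumr; apply: eq_bigr => i _.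
  by rewrite scalerA mulrC divfK.
have [l00|l00] := eqVneq (lam ord0) 0; first by rewrite l00 scale0r add0r subr0 scale1r.
apply: convex_set2 => //; last by apply: Kx; rewrite lt_neqAle eq_sym l00 l0.
by rewrite l0 -l1 lerDl.
Qed.
End convex_combinations.

Section box_fun_extra.
Variable R : realType.

Lemma box_fun_fin n (a : 'I_n -> bool) M r (f : 'rV[R]_n -> R) : 0 <= r ->
  box_fun a M r f -> mask_int a (EFin \o f) \is a fin_num.
Proof.
move=> r0; elim: n a M f => [|n IH] a M f bf; first by rewrite mask_int0.
by rewrite (mask_int_box_tail r0 bf) (IH _ _ _ (box_fun_tail r0 bf)).
Qed.

Lemma mask_int_fine n (a : 'I_n -> bool) M r (f : 'rV[R]_n -> R) : 0 <= r ->
  box_fun a M r f -> (fine (mask_int a (EFin \o f)))%:E = mask_int a (EFin \o f).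
Proof. by move=> r0 /(box_fun_fin r0)/fineK. Qed.
End box_fun_extra.

(** Count the incidences between points and sets of the cover. *)
Lemma uniform_cover_card (R : realType) n (S : {set 'I_n}) m
    (C : 'I_m -> {set 'I_n}) (q : 'I_m -> R) :
  uniform_cover S C q -> \sum_j q j * #|C j|%:R = #|S|%:R.
Proof.
move=> [_ CS _ Cq].
transitivity (\sum_j \sum_(i in S) q j * (i \in C j)%:R).
  apply: eq_bigr => j _; rewrite -mulr_sumr -natr_sum; congr (_ * _%:R).
  rewrite -sum1_card [LHS]big_mkcond [RHS]big_mkcond; apply: eq_bigr => i _.
  by case: ifP => iC; [rewrite (fintype.subsetP (CS j) _ iC)|case: ifP].
rewrite exchange_big/= -sum1_card natr_sum; apply: eq_bigr => i iS.
exact: Cq.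
Qed.

Section sections.
Variables (R : realType) (n : nat) (V : 'M[R]_n) (K : set 'rV[R]_n).
Variables (S : {set 'I_n}) (r : R).
Hypotheses (uV : V \in unitmx) (mK : measurable_rV K) (cK : convex_set K).
Hypotheses (r0 : 0 <= r) (bK : forall t i, K (t *m V) -> `|t 0 i| <= r).

Definition section_size (x : 'rV[R]_n) : R :=
  fine (mask_int (fun i => i \in ~: S) (EFin \o section_fun V K x)).

Definition slice_size (A : {set 'I_n}) : R :=
  fine (mask_int (fun i => i \in A) (EFin \o section_fun V K 0)).

Lemma section_fun_ge0 x t : 0 <= section_fun V K x t.
Proof. by rewrite /section_fun indicE. Qed.

Lemma section_size_ge0 x : 0 <= section_size x.
Proof. by apply/fine_ge0/mask_int_ge0 => t; rewrite lee_fin section_fun_ge0. Qed.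

Lemma slice_size_ge0 A : 0 <= slice_size A.
Proof. by apply/fine_ge0/mask_int_ge0 => t; rewrite lee_fin section_fun_ge0. Qed.

Lemma section_fun_eq0 x t : ~ K (x + t *m V) -> section_fun V K x t = 0.
Proof. by move=> nK; rewrite /section_fun indicE memNset. Qed.

Lemma section_fun_box (s : 'rV[R]_n) rho (a : 'I_n -> bool) :
  (forall i, `|s 0 i| <= rho) -> box_fun a 1 (r + rho) (section_fun V K (s *m V)).
Proof.
move=> srho; split.
- exact: mfun_section.
- by move=> t; rewrite section_fun_ge0 /section_fun indicE lern1 leq_b1.
- move=> t i _ ti; apply: section_fun_eq0; rewrite -mulmxDl => /(bK i).
  apply/negP; rewrite -ltNge; move: ti; rewrite -ltrBrDr => /lt_le_trans; apply.
  rewrite lerBlDr [s + t]addrC -{1}(addrK (s 0 i) (t 0 i)).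
  apply: le_trans (ler_normB _ _) _; rewrite mxE lerD2l; exact: srho.
Qed.

Lemma section_fun_box0 (a : 'I_n -> bool) : box_fun a 1 r (section_fun V K 0).
Proof.
have := @section_fun_box 0 0 a; rewrite mul0mx addr0; apply=> i.
by rewrite mxE normr0.
Qed.

(** Brunn-Minkowski along the sections: the indicator of a convex set is
    log-concave, and so are its integrals over parallel subspaces. *)
Lemma section_log_concave m (lam : 'I_m -> R) (x : 'I_m -> 'rV[R]_n) :
  (forall j, 0 <= lam j) -> \sum_j lam j = 1 ->
  \prod_j section_size (x j) `^ lam j <= section_size (\sum_j lam j *: x j).
Proof.
move=> l0 l1.
pose s j := x j *m invmx V.
have xE j : x j = s j *m V by rewrite /s mulmxKV.
have sE : \sum_j lam j *: x j = (\sum_j lam j *: s j) *m V.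
  rewrite mulmx_suml; apply: eq_bigr => j _; by rewrite -scalemxAl -xE.
(* [rho] bounds all the translations, so that one box contains all sections. *)
pose rho := \sum_j \sum_i `|s j 0 i| + \sum_i `|(\sum_j lam j *: s j) 0 i|.
have rho1 j i : `|s j 0 i| <= rho.
  rewrite /rho (bigD1 j)//= (bigD1 i)//= -!addrA lerDl !addr_ge0// ?sumr_ge0// => l _.
  exact: sumr_ge0.
have rho2 i : `|(\sum_j lam j *: s j) 0 i| <= rho.
  rewrite /rho [X in _ <= _ + X](bigD1 i)//= addrCA lerDl addr_ge0// sumr_ge0// => l _.
  exact: sumr_ge0.
have rr0 : 0 <= r + rho.
  by rewrite addr_ge0// /rho addr_ge0// sumr_ge0// => j _; exact: sumr_ge0.
pose a (i : 'I_n) := i \in ~: S.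
have bx j : box_fun a 1 (r + rho) (section_fun V K (x j)).
  by rewrite xE; exact: section_fun_box.
have bs : box_fun a 1 (r + rho) (section_fun V K (\sum_j lam j *: x j)).
  by rewrite sE; exact: section_fun_box.
have := @box_prekopa_leindler R m lam (fun=> 1) n a (fun=> a)
  (fun j => section_fun V K (x j)) (EFin \o section_fun V K (\sum_j lam j *: x j))
  1 1 (r + rho) ler01 l0 (fun=> ler01) rr0.
rewrite -(mask_int_fine rr0 bs) lee_fin mul1r.
under eq_bigr do rewrite expr1n mul1r.
apply => //.
- by move=> i ai; rewrite -l1; apply: eq_bigl => j; rewrite ai.
- by case: bs.
- by move=> t; rewrite lee_fin section_fun_ge0.
- move=> t; rewrite mul1r lee_fin.
  under [X in section_fun _ _ _ X]eq_bigr do rewrite mulr1.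
  have [[j [lj nK]]|/forallNP Kx] := pselect
      (exists j, 0 < lam j /\ ~ K (x j + t j *m V)).
    rewrite (bigD1 j)//= section_fun_eq0// powR0 ?gt_eqF// mul0r.
    exact: section_fun_ge0.
  rewrite [leRHS]/section_fun indicE mem_set.
    rewrite (_ : true%:R = \prod_(j < m) (1 : R)); last by rewrite big1_eq.
    apply: ler_prod => j _; rewrite powR_ge0/=.
    apply: (@le_trans _ _ (1 `^ lam j)); last by rewrite powR1.
    have [_ /(_ (t j))/andP[k0 k1] _] := bx j.
    by apply: ge0_ler_powR; rewrite ?nnegrE.
  rewrite mulmx_suml -big_split/=.
  under eq_bigr do rewrite -scalemxAl -scalerDr.
  apply: convex_set_sum => // j lj; apply: contrapT => nK; exact: (Kx j).
Qed.

Lemma section_size_box (a : 'I_n -> bool) M : (forall x, section_size x <= M) ->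
  (forall i, a i -> i \in S) -> box_fun a M r (fun s => section_size (s *m V)).
Proof.
move=> gM aS; split.
- have mk := mfun_section V 0 mK.
  have mD : measurable_fun setT (fun z : Rpow R n * Rpow R n =>
      (EFin \o section_fun V K 0) (Rpow_rV z.1 + Rpow_rV z.2)).
    apply: (mfun_rV_comp (phi := fun z => _ + _) mk).
    by apply: measurable_addrV; [exact: measurable_coord_fst|exact: measurable_coord_snd].
  have k0 s t : (0 <= (EFin \o section_fun V K 0) (s + t)%R)%E.
    by rewrite lee_fin section_fun_ge0.
  have := @measurable_mask_int R _ (Rpow R n) n (fun i => i \in ~: S)
    (fun s t => (EFin \o section_fun V K 0) (Rpow_rV s + t)) (fun s t => k0 _ _) mD.
  rewrite /mfun_rV; congr (measurable_fun _ _); apply/funext => s /=.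
  have rho i : `|(Rpow_rV s : 'rV[R]_n) 0 i| <= \sum_i `|(Rpow_rV s : 'rV[R]_n) 0 i|.
    by rewrite (bigD1 i)//= lerDl sumr_ge0.
  have rr0 : 0 <= r + \sum_i `|(Rpow_rV s : 'rV[R]_n) 0 i|.
    by rewrite addr_ge0// sumr_ge0.
  rewrite (mask_int_fine rr0 (section_fun_box _ rho)); apply: eq_mask_int => t /=.
  by rewrite /section_fun add0r mulmxDl.
- by move=> s; rewrite section_size_ge0 gM.
- move=> s i /aS iS si; rewrite /section_size.
  have m0 : mfun_rV (fun _ : 'rV[R]_n => 0%E : \bar R) by exact: measurable_cst.
  rewrite (mask_int_supported (mfun_section V _ mK) m0) //; last first.
  - move=> t tS /=; rewrite section_fun_eq0// -mulmxDl => /(bK i).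
    by rewrite mxE tS ?inE ?iS// addr0 leNgt si.
  - by move=> t; rewrite lee_fin section_fun_ge0.
  by rewrite /mask_int integral0.
Qed.

(** A slice along the coordinates of [A] and of the complement of [S] is swept by
    the sections through the points of the former. *)
Lemma slice_sizeE (A : {set 'I_n}) M : (forall x, section_size x <= M) ->
  A \subset S -> mask_int (fun i => i \in A) (EFin \o fun s => section_size (s *m V)) =
    (slice_size (A :|: ~: S))%:E.
Proof.
move=> gM AS; rewrite (mask_int_fine r0 (section_fun_box0 _)).
rewrite (@mask_int_conv _ _ (fun i => i \in A) (fun i => i \in ~: S)
  (fun i => i \in A :|: ~: S) (EFin \o section_fun V K 0)).
- apply: eq_mask_int => s /=.
  have rho i : `|s 0 i| <= \sum_i `|s 0 i| by rewrite (bigD1 i)//= lerDl sumr_ge0.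
  have rr0 : 0 <= r + \sum_i `|s 0 i| by rewrite addr_ge0// sumr_ge0.
  rewrite (mask_int_fine rr0 (section_fun_box _ rho)); apply: eq_mask_int => t /=.
  by rewrite /section_fun add0r mulmxDl.
- by move=> i; rewrite inE.
- by move=> i; rewrite inE; apply/negP => /andP[/(fintype.subsetP AS) ->].
- exact: mfun_section.
- by move=> t; rewrite lee_fin section_fun_ge0.
Qed.

(** After dilation by [#|C j| / #|S|], the sum of the [q j *: y j] becomes a
    convex combination of the points [x j] with weights [q j * #|C j| / #|S|].
    Log-concavity of the sections, together with the bound [M], which pays for
    the exponents lost in passing from [q j] to those weights, gives the
    hypothesis of the Prékopa-Leindler inequality for the cover. *)
Theorem cover_inequality m (C : 'I_m -> {set 'I_n}) (q : 'I_m -> R) M :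
  uniform_cover S C q -> (0 < #|S|)%N -> (forall x, section_size x <= M) ->
  (\prod_j (#|C j|%:R / #|S|%:R) `^ (q j * #|C j|%:R)) *
    \prod_j slice_size (C j :|: ~: S) `^ q j
  <= M `^ (\sum_j q j - 1) * slice_size [set: 'I_n]%SET.
Proof.
move=> [m0 CS q0 Cq] d0 gM.
pose th j : R := #|C j|%:R / #|S|%:R.
have dpos : 0 < #|S|%:R :> R by rewrite ltr0n.
have th0 j : 0 <= th j by rewrite divr_ge0.
have th1 j : th j <= 1.
  by rewrite ler_pdivrMr// mul1r ler_nat subset_leq_card.
have qge0 j : 0 <= q j by exact: ltW.
have M0 : 0 <= M by exact: le_trans (section_size_ge0 0) (gM 0).
have card_sum (A : {set 'I_n}) : (\sum_(i < n) (i \in A) = #|A|)%N.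
  by rewrite -sum1_card [RHS]big_mkcond; apply: eq_bigr => i _; case: (i \in A).
have lam1 : \sum_j q j * th j = 1.
  rewrite /th; under eq_bigr do rewrite mulrA.
  by rewrite -mulr_suml (uniform_cover_card (And4 m0 CS q0 Cq)) divff ?gt_eqF.
have lam0 j : 0 <= q j * th j by rewrite mulr_ge0.
have slice_pow : \prod_j (th j ^+ (\sum_(i < n) (i \in C j))%N *
      slice_size (C j :|: ~: S)) `^ q j =
    (\prod_j (th j) `^ (q j * #|C j|%:R)) * \prod_j slice_size (C j :|: ~: S) `^ q j.
  rewrite -big_split/=; apply: eq_bigr => j _; rewrite card_sum powRM ?exprn_ge0//.
    by rewrite -powR_mulrn// -powRrM [_%:R * _]mulrC.
  exact: slice_size_ge0.
rewrite -slice_pow; set X := (X in X <= _).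
have full : S :|: ~: S = [set: 'I_n]%SET by rewrite finset.setUCr.
have key : (forall x : 'I_m -> 'rV[R]_n, M `^ (1 - \sum_j q j) *
      \prod_j section_size (x j) `^ q j <= section_size (\sum_j (q j * th j) *: x j)) ->
    M `^ (1 - \sum_j q j) * X <= slice_size [set: 'I_n]%SET.
  move=> gx.
  have := @box_prekopa_leindler R m q th n (fun i => i \in S)
    (fun j i => i \in C j) (fun j s => section_size (s *m V))
    (EFin \o fun s => section_size (s *m V)) (M `^ (1 - \sum_j q j)) M r
    (powR_ge0 _ _) qge0 th0 r0.
  rewrite (slice_sizeE gM (subxx S)) full lee_fin.
  under eq_bigr do rewrite (slice_sizeE gM (CS _)).
  apply.
  - move=> i /Cq <-; rewrite big_mkcond; apply: eq_bigr => j _.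
    by case: (i \in C j); rewrite ?mulr1 ?mulr0.
  - by move=> i j; apply: contra; exact: (fintype.subsetP (CS j)).
  - by move=> j; apply: section_size_box => // i; exact: (fintype.subsetP (CS j)).
  - by case: (@section_size_box (fun i => i \in S) M gM (fun i iS => iS)).
  - by move=> t; rewrite lee_fin section_size_ge0.
  - move=> x; rewrite lee_fin; apply: le_trans (gx (fun j => x j *m V)) _.
    rewrite mulmx_suml; under [X in _ <= section_size X]eq_bigr do rewrite -scalemxAl.
    by [].
have [M_eq0|M_neq0] := eqVneq M 0.
  have j0 : 'I_m by exact: Ordinal m0.
  rewrite /X (bigD1 j0)//= (_ : slice_size _ = 0) ?mulr0 ?powR0 ?gt_eqF// ?mul0r.
    by rewrite mulr_ge0 ?powR_ge0// slice_size_ge0.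
  apply/EFin_inj; rewrite -(slice_sizeE gM (CS j0)).
  have g0 s : (EFin \o fun s => section_size (s *m V)) s = 0%E.
    by congr EFin; apply/le_anti; rewrite section_size_ge0 -[X in _ <= X]M_eq0 gM.
  by rewrite (eq_mask_int _ g0) /mask_int integral0.
have Mpos : 0 < M by rewrite lt_neqAle eq_sym M_neq0.
have Mpow : M `^ (\sum_j q j - 1) * M `^ (1 - \sum_j q j) = 1.
  rewrite -powRD; last by apply/implyP.
  by rewrite addrA subrK subrr powRr0.
have -> : X = M `^ (\sum_j q j - 1) * (M `^ (1 - \sum_j q j) * X).
  by rewrite mulrA Mpow mul1r.
rewrite ler_wpM2l ?powR_ge0//; apply: key => x.
apply: le_trans (section_log_concave _ lam0 lam1).
have -> : M `^ (1 - \sum_j q j) = \prod_j M `^ (q j * th j - q j).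
  by rewrite -powR_sum// sumrB lam1.
rewrite -big_split/=; apply: ler_prod => j _.
rewrite mulr_ge0 ?powR_ge0//=.
set g := section_size _.
have g0 : 0 <= g by exact: section_size_ge0.
have [g_eq0|g_neq0] := eqVneq g 0.
  by rewrite g_eq0 powR0 ?gt_eqF// mulr0 powR_ge0.
have gpos : 0 < g by rewrite lt_neqAle eq_sym g_neq0.
have -> : g `^ (q j * th j) = g `^ (q j * th j - q j) * g `^ q j.
  by rewrite -powRD ?subrK//; apply/implyP.
rewrite ler_wpM2r ?powR_ge0//.
have -> : q j * th j - q j = - (q j - q j * th j) by rewrite opprB.
rewrite !powRN lef_pV2 ?posrE ?powR_gt0//; apply: ge0_ler_powR; rewrite ?nnegrE//.
  by rewrite subr_ge0 ler_piMr.
exact: gM.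
Qed.
End sections.

(** * The largest section of a compact set *)


Section usc_max.
Variables (R : realType) (T : ptopologicalType) (phi : T -> R).

Lemma seq_argmax (x0 : T) (s : seq T) :
  exists2 m, m \in x0 :: s & forall x, x \in x0 :: s -> phi x <= phi m.
Proof.
elim: s x0 => [|y s IH] x0.
  by exists x0; rewrite ?mem_head// => x; rewrite inE => /eqP ->.
have [m ms mP] := IH y; have [xm|mx] := leP (phi x0) (phi m).
  by exists m => [|x]; rewrite inE ?ms ?orbT// => /predU1P[->|/mP].
exists x0 => [|x]; first exact: mem_head.
by rewrite inE => /predU1P[->//|/mP] /le_trans; apply; exact: ltW.
Qed.

(** If no maximum existed, the open sets on which the function is smaller than
    one of its values would cover the compact set. *)
Lemma compact_usc_max (K : set T) : compact K -> K !=set0 ->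
  (forall c, open [set x | phi x < c]) ->
  exists2 z, K z & forall x, K x -> phi x <= phi z.
Proof.
move=> cK [x0 Kx0] usc; apply: contrapT => /forall2NP nomax.
have cov : K `<=` \bigcup_(x in K) [set y | phi y < phi x].
  move=> z Kz; have [//|] := nomax z; move/existsNP => [x] /not_implyP[Kx].
  by move/negP; rewrite -ltNge => zx; exists x.
move: cK; rewrite compact_cover => /(_ _ _ _ (fun x _ => usc (phi x)) cov).
move=> [D DK KD].
have [y yD _] := KD _ Kx0.
have [m mD mP] := seq_argmax y (finmap.enum_fset D).
have {}mD : m \in finmap.enum_fset D by move: mD; rewrite inE => /predU1P[->|].
have [z zD /=] := KD m (set_mem (DK _ mD)).
by rewrite ltNge mP// inE zD orbT.
Qed.
End usc_max.

Section bounded_sets.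
Variables (R : realType) (n : nat).

Lemma compact_coord_bounded (K : set 'rV[R]_n) : compact K ->
  exists2 r, 0 <= r & forall z i, K z -> `|z 0 i| <= r.
Proof.
move=> /compact_bounded[M [_ KM]].
exists (`|M| + 1) => [|z i Kz]; first by rewrite addr_ge0.
have := KM (`|M| + 1) _ z Kz; rewrite {1}(le_lt_trans (ler_norm M)) ?ltrDl// => /(_ isT).
apply: le_trans; rewrite (_ : `|z| = mx_norm z)// mx_normrE.
exact: (le_bigmax _ (fun ij => `|z ij.1 ij.2|) (0, i)).
Qed.

Lemma coord_bounded_frame (V : 'M[R]_n) (B : set 'rV[R]_n) r : V \in unitmx ->
  (forall z i, B z -> `|z 0 i| <= r) ->
  exists2 r', 0 <= r' & forall t i, B (t *m V) -> `|t 0 i| <= r'.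
Proof.
move=> uV Br.
pose c := \sum_i \sum_j `|invmx V j i|.
have c0 : 0 <= c by apply: sumr_ge0 => i _; exact: sumr_ge0.
exists (`|r| * c) => [|t i Bt]; first exact: mulr_ge0.
rewrite -(mulmxK uV t) mxE; apply: (le_trans (ler_norm_sum _ _ _)).
apply: (@le_trans _ _ (\sum_j `|r| * `|invmx V j i|)).
  apply: ler_sum => j _; rewrite normrM ler_wpM2r//.
  exact: le_trans (Br _ j Bt) (ler_norm _).
rewrite -mulr_sumr ler_wpM2l// /c [leRHS](bigD1 i)//= lerDl.
by apply: sumr_ge0 => k _; exact: sumr_ge0.
Qed.
End bounded_sets.

Section section_max.
Variables (R : realType) (n : nat) (V : 'M[R]_n) (K : set 'rV[R]_n).
Variable (S : {set 'I_n}).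
Hypotheses (uV : V \in unitmx) (cK : compact K).

Let hK : closed K.
Proof. by apply: compact_closed cK; exact: norm_hausdorff. Qed.

Let mK : measurable_rV K. Proof. exact: closed_measurable_rV. Qed.

Lemma section_size_translate x t : supported (~: S) t ->
  section_size V K S (x + t *m V) = section_size V K S x.
Proof.
move=> tS; rewrite /section_size; congr fine.
have [k [E [EE DE intE]]] := mask_int_embed R (fun i : 'I_n => i \in ~: S).
have k0 y s : (0 <= (EFin \o section_fun V K y) s)%E.
  by rewrite lee_fin section_fun_ge0.
rewrite !intE; try exact: mfun_section; try exact: k0.
pose f (s : 'rV[R]_k) := (EFin \o section_fun V K x) (s *m E).
have mf : mfun_rV f.
  have := mfun_rV_affine E 0 (mfun_section V x mK).
  by rewrite /f; under eq_fun do rewrite addr0.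
have := leb_int_cov (t *m E^T) (unitmx1 R k) mf (fun s => k0 _ _).
rewrite det1 normr1 invr1 mul1e => <-; apply: eq_mask_int => s.
rewrite /f /= /section_fun mulmx1 mulmxDl -(mulmxA t) DE.
rewrite (supported_maskmx tS) mulmxDl.
by rewrite -!addrA [t *m V + _]addrC.
Qed.

(** Open neighbourhoods of [K]: they are Borel and decrease to [K]. *)
Let fat (i : nat) : set 'rV[R]_n := \bigcup_(k in K) ball k i.+1%:R^-1.

Let fat_open i : open (fat i).
Proof. by apply: bigcup_open => k _; exact: ball_open. Qed.

Let fatK : \bigcap_i fat i = K.
Proof.
apply/seteqP; split=> [z zf|z Kz i _]; last first.
  by exists z => //; exact: ballxx.
apply: hK => B /nbhs_ballP[e /= e0 eB].
have [i ie] : exists i : nat, i.+1%:R^-1 < e.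
  by have [N _ /(_ N (leqnn N))] := near_infty_natSinv_lt (PosNum e0); exists N.
have [k Kk kz] := zf i Logic.I.
by exists k; split => //; apply: eB; apply/ball_sym; exact: le_ball (ltW ie) _ kz.
Qed.

Let fat_section (x : 'rV[R]_n) i : set (Rpow R n) :=
  [set y | fat i (x + Rpow_rV y *m V)].

Let fat_sectionE x i :
  mask_int (fun i => i \in ~: S) (EFin \o section_fun V (fat i) x) =
  mask_measure R (fun i => i \in ~: S) (fat_section x i).
Proof.
rewrite /mask_int -(setIT (fat_section x i)) -integral_indic//.
have := measurable_rV_preim V x (open_measurable_rV (@fat_open i)).
by rewrite /measurable_rV; congr measurable; apply/seteqP; split => y /=; rewrite addrC.
Qed.

Let measurable_fat_section x i : measurable (fat_section x i).
Proof.
have := measurable_rV_preim V x (open_measurable_rV (@fat_open i)).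
by rewrite /measurable_rV; congr measurable; apply/seteqP; split => y /=; rewrite addrC.
Qed.

Let fat_section_fin x : (mask_measure R (fun i => i \in ~: S) (fat_section x 0) < +oo)%E.
Proof.
have [r r0 Kr] := compact_coord_bounded cK.
have fr z i : fat 0 z -> `|z 0 i| <= r + 1.
  move=> [k Kk [_ /(_ 0 i)]]; rewrite /ball/= invr1 => kz.
  rewrite -(subrK (k 0 i) (z 0 i)) addrC; apply: (le_trans (ler_normD _ _)).
  by rewrite lerD ?Kr// distrC ltW.
have [r' r'0 fr'] := coord_bounded_frame uV fr.
have rho i : `|(x *m invmx V) 0 i| <= \sum_i `|(x *m invmx V) 0 i|.
  by rewrite (bigD1 i)//= lerDl sumr_ge0.
have rr0 : 0 <= r' + \sum_i `|(x *m invmx V) 0 i| by rewrite addr_ge0// sumr_ge0.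
have := box_fun_fin rr0 (section_fun_box (open_measurable_rV (@fat_open 0)) fr'
  (fun i => i \in ~: S) rho); rewrite mulmxKV// fat_sectionE.
by rewrite ge0_fin_numE.
Qed.

Let fat_section_cvg x :
  mask_measure R (fun i => i \in ~: S) (fat_section x i) @[i --> \oo] -->
  mask_int (fun i => i \in ~: S) (EFin \o section_fun V K x).
Proof.
have -> : mask_int (fun i => i \in ~: S) (EFin \o section_fun V K x) =
    mask_measure R (fun i => i \in ~: S) (\bigcap_i fat_section x i).
  rewrite /mask_int -(setIT (\bigcap_i _)) -integral_indic//; last first.
    by apply: bigcapT_measurable => i; exact: measurable_fat_section.
  apply: eq_integral => y _ /=; congr EFin; rewrite /section_fun !indicE.
  congr (_%:R); congr nat_of_bool; rewrite -[in LHS]fatK.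
  by apply/idP/idP; rewrite !inE.
apply: nonincreasing_cvg_mu => //.
- exact: fat_section_fin.
- by apply: bigcapT_measurable => i; exact: measurable_fat_section.
- move=> i j ij; apply/subsetPset => y [k Kk ky]; exists k => //.
  by apply: le_ball ky; rewrite lef_pV2 ?posrE// ler_nat.
Qed.

Let section_fun_fin x :
  mask_int (fun i => i \in ~: S) (EFin \o section_fun V K x) \is a fin_num.
Proof.
have [r r0 Kr] := compact_coord_bounded cK.
have [r' r'0 Kr'] := coord_bounded_frame uV Kr.
have rho i : `|(x *m invmx V) 0 i| <= \sum_i `|(x *m invmx V) 0 i|.
  by rewrite (bigD1 i)//= lerDl sumr_ge0.
have rr0 : 0 <= r' + \sum_i `|(x *m invmx V) 0 i| by rewrite addr_ge0// sumr_ge0.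
have := box_fun_fin rr0 (section_fun_box mK Kr' (fun i => i \in ~: S) rho).
by rewrite mulmxKV.
Qed.

(** The sections of the open neighbourhoods of [K] decrease to those of [K]. *)
Lemma section_size_usc c : open [set x | section_size V K S x < c].
Proof.
rewrite openE => x /= xc.
have [i ic] : exists i,
    (mask_measure R (fun i => i \in ~: S) (fat_section x i) < c%:E)%E.
  apply: contrapT => /forallNP ci; move: xc; apply/negP; rewrite -leNgt.
  rewrite -lee_fin /section_size fineK//.
  rewrite -(cvg_lim (@ereal_hausdorff R) (@fat_section_cvg x)); apply: lime_ge.
    by apply/cvg_ex; eexists; exact: fat_section_cvg.
  by apply: nearW => i; rewrite leNgt; apply/negP; exact: ci.
apply/nbhs_ballP; exists i.+1%:R^-1 => /=; first by rewrite invr_gt0.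
move=> y xy /=; rewrite -lte_fin /section_size fineK//.
apply: le_lt_trans ic; rewrite -fat_sectionE; apply: mask_int_le.
- exact: mfun_section.
- exact: mfun_section (open_measurable_rV (@fat_open i)).
- by move=> t; rewrite lee_fin section_fun_ge0.
- move=> t; rewrite /= lee_fin; have [Kt|nKt] := pselect (K (y + t *m V)); last first.
    by rewrite section_fun_eq0// section_fun_ge0.
  rewrite /section_fun !indicE [in leRHS]mem_set ?leq_b1 ?ler_nat ?leq_b1//.
  exists (y + t *m V) => //; apply: ball_sym.
  move: xy; rewrite !mx_norm_ball /ball_/=.
  by rewrite opprD addrACA subrr addr0.
Qed.

(** A section of positive size passes through a point of [K], and translation
    along the section does not change its size. *)
Lemma section_size_max : K !=set0 -> exists z,
  forall x, section_size V K S x <= section_size V K S z.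
Proof.
move=> K0; have [z Kz zmax] := compact_usc_max cK K0 section_size_usc.
exists z => x.
have [[t tS Kt]|/forall2NP nK] := pselect (exists2 t, supported (~: S) t & K (x + t *m V)).
  by rewrite -(section_size_translate x tS) zmax.
rewrite (_ : section_size V K S x = 0) ?section_size_ge0// /section_size.
have m0 : mfun_rV (fun _ : 'rV[R]_n => 0%E : \bar R) by exact: measurable_cst.
rewrite (mask_int_supported (mfun_section V x mK) m0) ?/mask_int ?integral0//.
  by move=> t; rewrite lee_fin section_fun_ge0.
move=> t tS /=; rewrite section_fun_eq0//.
by have [|] := nK t.
Qed.
End section_max.

(** * Volume inequalities in a general frame *)


Section powR_extra.
Variable R : realType.

Lemma powR_div (a b q : R) : 0 <= a -> 0 <= b -> (a / b) `^ q = a `^ q / b `^ q.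
Proof.
move=> a0 b0; rewrite powRM ?invr_ge0//; congr (_ * _).
by rewrite -(powR_inv1 b0) -powRrM mulN1r powRN.
Qed.

Lemma prod_powR_div m (a b q : 'I_m -> R) :
  (forall j, 0 <= a j) -> (forall j, 0 <= b j) ->
  \prod_j (a j / b j) `^ q j = \prod_j a j `^ q j / \prod_j b j `^ q j.
Proof.
by move=> a0 b0; rewrite -prodf_div; apply: eq_bigr => j _; rewrite powR_div.
Qed.
End powR_extra.

Section volume_inequalities.
Variables (R : realType) (n : nat) (U : 'M[R]_n) (K : set 'rV[R]_n).
Variables (S : {set 'I_n}) (G : {vspace 'rV[R]_n}) (x0 : 'rV[R]_n).
Hypotheses (uU : U \in unitmx) (cK : compact K) (convK : convex_set K).
Hypotheses (UG : coord_space U (~: S) G) (gG : gram_vol U (~: S) = 1).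

Local Notation M := (affine_vol G x0 K).
Hypothesis maxM : forall x, affine_vol G x K <= M.

Let mK : measurable_rV K.
Proof.
by apply: closed_measurable_rV; apply: compact_closed cK; exact: norm_hausdorff.
Qed.

Lemma affine_vol_section x : affine_vol G x K = section_size U K S x.
Proof. by rewrite (affine_vol_coord _ uU UG mK) gG mul1r. Qed.

Lemma affine_vol_slice A F : coord_space U A F ->
  affine_vol F 0 K = gram_vol U A * slice_size U K A.
Proof. by move=> UF; rewrite (affine_vol_coord _ uU UF mK). Qed.

Lemma vol_slice : vol K = gram_vol U [set: 'I_n]%SET * slice_size U K [set: 'I_n]%SET.
Proof.
rewrite /vol lebesgue_rVE// /gram_vol gram_detT sqrtr_sqr /slice_size.
pose f (x : 'rV[R]_n) : \bar R := (\1_K x : R)%:E.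
have f0 x : (0 <= f x)%E by rewrite lee_fin indicE.
rewrite (_ : mask_int _ _ = leb_int (fun x => f (x *m U + 0))); last first.
  rewrite /leb_int; congr mask_int; first by apply/funext => i; rewrite finset.in_setT.
  by apply/funext => t /=; rewrite /section_fun add0r /f addr0.
rewrite leb_int_cov//; last exact: mfun_rV_indic.
have dU : `|\det U| != 0 by rewrite normr_eq0 -unitfE -unitmxE.
have [gfin|] := boolP (leb_int f \is a fin_num).
  by rewrite -(fineK gfin) -EFinM /= mulrA mulfV ?mul1r.
rewrite ge0_fin_numE; last by apply: mask_int_ge0.
rewrite -leNgt leye_eq => /eqP ->.
by rewrite gt0_muley ?mulr0// lte_fin invr_gt0 lt_neqAle eq_sym dU normr_ge0.
Qed.

Lemma affine_vol_ge0 A F : coord_space U A F -> 0 <= affine_vol F 0 K.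
Proof.
by move=> UF; rewrite (affine_vol_slice UF) mulr_ge0 ?sqrtr_ge0 ?slice_size_ge0.
Qed.

Lemma vol_ge0 : 0 <= vol K.
Proof. by rewrite vol_slice mulr_ge0 ?sqrtr_ge0 ?slice_size_ge0. Qed.

Lemma maxM_ge0 : 0 <= M.
Proof. by rewrite affine_vol_section section_size_ge0. Qed.

(** If [S] is empty then [p] may be smaller than 1, and all the sections and
    slices are [K] itself. *)
Section degenerate.
Hypothesis S0 : S = finset.set0.

Let setCS : ~: S = [set: 'I_n]%SET. Proof. by rewrite S0 finset.setC0. Qed.

Lemma affine_vol_degenerate A F : coord_space U (A :|: ~: S) F ->
  affine_vol F 0 K = vol K.
Proof. by rewrite setCS finset.setUT => UF; rewrite (affine_vol_slice UF) vol_slice. Qed.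

Lemma max_degenerate : M = vol K.
Proof.
rewrite affine_vol_section -[x0](mulmxKV uU) -[_ *m U]add0r.
rewrite section_size_translate//; last by move=> i; rewrite setCS inE.
rewrite -affine_vol_section; apply: (@affine_vol_degenerate finset.set0).
by rewrite finset.set0U.
Qed.

Lemma gram_vol_degenerate A : gram_vol U (A :|: ~: S) = 1.
Proof. by rewrite setCS finset.setUT -setCS gG. Qed.

Lemma gram_volT_degenerate : gram_vol U [set: 'I_n]%SET = 1.
Proof. by rewrite -setCS gG. Qed.
End degenerate.

(** Gram volumes convert the coordinate measures of the slices into volumes. *)
Lemma cover_volume_inequality m (C : 'I_m -> {set 'I_n}) (q : 'I_m -> R)
    (F : 'I_m -> {vspace 'rV[R]_n}) :
  uniform_cover S C q -> (forall j, coord_space U (C j :|: ~: S) (F j)) ->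
  gram_vol U [set: 'I_n]%SET / (\prod_j gram_vol U (C j :|: ~: S) `^ q j) *
    ((\prod_j #|C j|%:R `^ (q j * #|C j|%:R)) / #|S|%:R ^+ #|S|) *
    \prod_j affine_vol (F j) 0 K `^ q j
  <= M `^ (\sum_j q j - 1) * vol K.
Proof.
move=> cov UF; have [m0 CS q0 Cq] := cov.
have j0 : 'I_m := Ordinal m0.
have q_gt0 : 0 < \sum_j q j.
  by rewrite (bigD1 j0)//= ltr_pwDl// sumr_ge0// => j _; exact: ltW.
have gpos j : 0 < gram_vol U (C j :|: ~: S) := gram_vol_gt0 uU (UF j).
have [/eqP|Spos] := posnP #|S|.
  rewrite cards_eq0 => /eqP S0.
  have C0 j : C j = finset.set0 by apply/eqP; rewrite -finset.subset0 -S0 CS.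
  rewrite gram_volT_degenerate// max_degenerate//.
  under eq_bigr do rewrite gram_vol_degenerate// powR1.
  under [X in _ * (X / _) * _]eq_bigr do rewrite C0 cards0 mulr0 powRr0.
  under [X in _ * X <= _]eq_bigr do rewrite (affine_vol_degenerate S0 (UF _)).
  rewrite !big1_eq S0 cards0 expr0 !divr1 !mul1r.
  have [v0|v_neq0] := eqVneq (vol K) 0.
    by rewrite v0 mulr0 (bigD1 j0)//= powR0 ?gt_eqF// mul0r.
  rewrite -powR_sum; last by rewrite lt_neqAle eq_sym v_neq0 vol_ge0.
  by rewrite mulrC mulr_powRB1// vol_ge0.
have dpos : 0 < #|S|%:R :> R by rewrite ltr0n.
have [r r0 Kr] := compact_coord_bounded cK.
have [r' r'0 Kr'] := coord_bounded_frame uU Kr.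
have gM x : section_size U K S x <= M by rewrite -affine_vol_section.
have := cover_inequality uU mK convK r'0 Kr' cov Spos gM.
have -> : \prod_j (#|C j|%:R / #|S|%:R) `^ (q j * #|C j|%:R) =
    (\prod_j #|C j|%:R `^ (q j * #|C j|%:R)) / #|S|%:R ^+ #|S| :> R.
  rewrite (prod_powR_div (fun j => q j * #|C j|%:R)) //; congr (_ / _).
  by rewrite -powR_sum// (uniform_cover_card cov) powR_mulrn// ltW.
have -> : \prod_j slice_size U K (C j :|: ~: S) `^ q j =
    \prod_j affine_vol (F j) 0 K `^ q j / \prod_j gram_vol U (C j :|: ~: S) `^ q j.
  rewrite -prod_powR_div; last 2 first.
  - by move=> j; exact: affine_vol_ge0.
  - by move=> j; exact: ltW.
  apply: eq_bigr => j _; congr (_ `^ _).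
  by rewrite (affine_vol_slice (UF j)) mulrC mulKf// gt_eqF.
set c := _ / _ ^+ _; set a := \prod_j affine_vol _ _ _ `^ _; set g := \prod_j gram_vol _ _ `^ _.
move=> key; rewrite vol_slice [leRHS]mulrCA.
have -> : gram_vol U [set: 'I_n]%SET / g * c * a = gram_vol U [set: 'I_n]%SET * (c * (a / g)).
  by ring.
by rewrite ler_wpM2l// sqrtr_ge0.
Qed.

(** The complements of the sets of the cover form a uniform cover too, with
    weights [q j / (p - 1)]; this is the previous inequality for that cover,
    raised to the power [p - 1]. *)
Lemma cocover_volume_inequality m (C : 'I_m -> {set 'I_n}) (q : 'I_m -> R)
    (F : 'I_m -> {vspace 'rV[R]_n}) :
  uniform_cover S C q -> (forall j, coord_space U ((S :\: C j) :|: ~: S) (F j)) ->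
  gram_vol U [set: 'I_n]%SET `^ (\sum_j q j - 1) /
      (\prod_j gram_vol U ((S :\: C j) :|: ~: S) `^ q j) *
    ((\prod_j #|S :\: C j|%:R `^ (q j * #|S :\: C j|%:R)) /
       #|S|%:R `^ (#|S|%:R * (\sum_j q j - 1))) *
    \prod_j affine_vol (F j) 0 K `^ q j
  <= M * vol K `^ (\sum_j q j - 1).
Proof.
move=> cov UF; have [m0 CS q0 Cq] := cov.
have j0 : 'I_m := Ordinal m0.
have q_ge0 j : 0 <= q j by exact: ltW.
have q_gt0 : 0 < \sum_j q j.
  by rewrite (bigD1 j0)//= ltr_pwDl// sumr_ge0.
have gpos j : 0 < gram_vol U ((S :\: C j) :|: ~: S) := gram_vol_gt0 uU (UF j).
set p := \sum_j q j in q_gt0 *.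
have [/eqP|Spos] := posnP #|S|.
  rewrite cards_eq0 => /eqP S0.
  have C0 j : S :\: C j = finset.set0 by rewrite S0 finset.set0D.
  rewrite gram_volT_degenerate// powR1 max_degenerate//.
  under eq_bigr do rewrite gram_vol_degenerate// powR1.
  under [X in _ * (X / _) * _]eq_bigr do rewrite C0 cards0 mulr0 powRr0.
  under [X in _ * X <= _]eq_bigr do rewrite (affine_vol_degenerate S0 (UF _)).
  rewrite !big1_eq S0 cards0 mul0r powRr0 !divr1 !mul1r mulr_powRB1 ?vol_ge0//.
  have [v0|v_neq0] := eqVneq (vol K) 0.
    by rewrite v0 (bigD1 j0)//= powR0 ?gt_eqF// mul0r powR_ge0.
  by rewrite -powR_sum// lt_neqAle eq_sym v_neq0 vol_ge0.
have dpos : 0 < #|S|%:R :> R by rewrite ltr0n.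
have [i iS] : exists i, i \in S by apply/card_gt0P.
have p_ge1 : 1 <= p.
  rewrite -(Cq i iS); apply: ler_sum => j _.
  by case: (i \in C j); rewrite ?mulr1// mulr0.
(* For [p = 1] the sets of the cover equal [S], so that their complements are
   empty. *)
have [p1|p_neq1] := eqVneq p 1.
  have CE j : S :\: C j = finset.set0.
    apply/finset.setP => k; rewrite !inE; apply/negbTE/negP => /andP[kC kS].
    have : \sum_j q j * (k \in C j)%:R < p.
      rewrite (bigD1 j)//= (negbTE kC) mulr0 add0r /p [ltRHS](bigD1 j)//=.
      rewrite -[ltLHS]add0r ltr_leD//; apply: ler_sum => l _.
      by case: (k \in C l); rewrite ?mulr1// mulr0.
    by rewrite Cq// p1 ltxx.
  rewrite p1 subrr !mulr0 !powRr0 mulr1 divr1.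
  under eq_bigr do rewrite CE finset.set0U gG powR1.
  under [X in _ * X * _]eq_bigr do rewrite CE cards0 mulr0 powRr0.
  rewrite !big1_eq divr1 !mul1r.
  have -> : \prod_j affine_vol (F j) 0 K `^ q j = \prod_j affine_vol G 0 K `^ q j.
    apply: eq_bigr => j _; congr (_ `^ _).
    have UFj := UF j; rewrite CE finset.set0U in UFj.
    by rewrite (affine_vol_slice UFj) (affine_vol_slice UG).
  have G0 : 0 <= affine_vol G 0 K by exact: affine_vol_ge0 UG.
  have [v0|v_neq0] := eqVneq (affine_vol G 0 K) 0.
    by rewrite v0 (bigD1 j0)//= powR0 ?gt_eqF// mul0r maxM_ge0.
  rewrite -powR_sum -/p ?p1 ?powRr1//; last by rewrite lt_neqAle eq_sym v_neq0.
have p_gt1 : 0 < p - 1 by rewrite subr_gt0 lt_neqAle eq_sym p_neq1.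
pose q' j := q j / (p - 1).
have cov' : uniform_cover S (fun j => S :\: C j) q'.
  split => //.
  - by move=> j; exact: finset.subsetDl.
  - by move=> j; rewrite divr_gt0.
  - move=> k kS; rewrite /q'; under eq_bigr do rewrite mulrAC.
    rewrite -mulr_suml; apply: (mulIf (lt0r_neq0 p_gt1)).
    rewrite divfK ?gt_eqF// mul1r.
    have -> : p - 1 = \sum_j (q j - q j * (k \in C j)%:R) by rewrite sumrB (Cq k kS).
    apply: eq_bigr => j _.
    by rewrite !inE kS andbT; case: (k \in C j); rewrite /= ?mulr1 ?mulr0 ?subrr ?subr0.
have q'q j : q' j * (p - 1) = q j by rewrite /q' divfK// gt_eqF.
have := cover_volume_inequality cov' UF.
have pw (x y : 'I_m -> R) : (forall j, 0 <= x j) ->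
    (\prod_j x j `^ (q' j * y j)) `^ (p - 1) = \prod_j x j `^ (q j * y j).
  move=> x0'; rewrite powR_prod => [|j _]; last exact: powR_ge0.
  by apply: eq_bigr => j _; rewrite -powRrM mulrAC q'q.
have pw1 (x : 'I_m -> R) : (forall j, 0 <= x j) ->
    (\prod_j x j `^ q' j) `^ (p - 1) = \prod_j x j `^ q j.
  move=> x0'; rewrite powR_prod => [|j _]; last exact: powR_ge0.
  by apply: eq_bigr => j _; rewrite -powRrM q'q.
have pr0 (x y : 'I_m -> R) : 0 <= \prod_j x j `^ y j.
  by apply: prodr_ge0 => j _; exact: powR_ge0.
have aff0 j : 0 <= affine_vol (F j) 0 K by exact: affine_vol_ge0 (UF j).
have sum_q' : \sum_j q' j - 1 = (p - 1)^-1.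
  rewrite /q' -mulr_suml -/p; apply: (mulIf (lt0r_neq0 p_gt1)).
  by rewrite mulrBl divfK ?gt_eqF// mul1r mulVf ?gt_eqF//; ring.
rewrite sum_q' => key.
have gram0 : 0 <= gram_vol U [set: 'I_n]%SET by exact: sqrtr_ge0.
have d0 : 0 <= #|S|%:R ^+ #|S| :> R by rewrite exprn_ge0// ltW.
have A0 : 0 <= gram_vol U [set: 'I_n]%SET /
    (\prod_j gram_vol U ((S :\: C j) :|: ~: S) `^ q' j).
  by rewrite divr_ge0.
have B0 : 0 <= (\prod_j #|S :\: C j|%:R `^ (q' j * #|S :\: C j|%:R)) /
    #|S|%:R ^+ #|S| :> R by rewrite divr_ge0.
have lhs0 := mulr_ge0 (mulr_ge0 A0 B0) (pr0 (fun j => affine_vol (F j) 0 K) q').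
have rhs0 := mulr_ge0 (powR_ge0 M (p - 1)^-1) vol_ge0.
have := ge0_ler_powR (ltW p_gt1) lhs0 rhs0 key.
rewrite (powRM _ (mulr_ge0 A0 B0) (pr0 _ _)) (powRM _ A0 B0).
rewrite (powRM _ (powR_ge0 _ _) vol_ge0) !powR_div//.
rewrite !pw1//; last by move=> j; exact: ltW.
rewrite (pw (fun j => #|S :\: C j|%:R) (fun j => #|S :\: C j|%:R))//.
rewrite -powR_mulrn ?(ltW dpos)// -!powRrM mulVf ?gt_eqF// powRr1//.
exact: maxM_ge0.
Qed.
End volume_inequalities.

(** * The inequalities for the four families of sections *)


Section constants.
Variables (R : realType) (m : nat) (q a : 'I_m -> R) (s : R).
Hypotheses (s0 : 0 < s) (a0 : forall j, 0 <= a j).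
Let p := \sum_j q j.

Lemma prod_powR_divl : \prod_j (a j / s) `^ q j = (\prod_j a j `^ q j) / s `^ p.
Proof.
by rewrite (prod_powR_div q a0) => [|j]; rewrite ?powR_sum// ltW.
Qed.

(** In the dual frame each of the volumes is divided by [s]; the resulting power
    [s ^ p] turns one Brascamp-Lieb constant into the other. *)
Lemma dual_constant1 :
  s^-1 / \prod_j (a j / s) `^ q j = ((\prod_j a j `^ q j) / s `^ (p - 1))^-1.
Proof.
rewrite prod_powR_divl !invfM !invrK mulrCA; congr (_ * _).
rewrite powRB; last by apply/implyP => _; rewrite gt_eqF.
by rewrite powRr1 1?mulrC// ltW.
Qed.

Lemma dual_constant2 :
  s^-1 `^ (p - 1) / \prod_j (a j / s) `^ q j = ((\prod_j a j `^ q j) / s)^-1.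
Proof.
rewrite prod_powR_divl !invfM !invrK mulrCA; congr (_ * _).
rewrite -(powR_inv1 (ltW s0)) -powRrM -powRD; last first.
  by apply/implyP => _; rewrite gt_eqF.
by rewrite (_ : -1 * (p - 1) + p = 1) ?powRr1 ?ltW//; ring.
Qed.
End constants.

Theorem theorem1p7 (R : realType) (n : nat) (w : 'I_n -> 'rV[R]_n)
    (w_basis : basis_of fullv [tuple w i | i < n])
    (S : {set 'I_n}) (m : nat) (C : 'I_m -> {set 'I_n}) (q : 'I_m -> R)
    (cover : uniform_cover S C q)
    (K : set 'rV[R]_n) (K_body : convex_body K) :
  let d := #|S| in
  let H := spanv w S in
  let Hj j := spanv w (C j) in
  let Ht j := spanv w (S :\: C j) in
  let dj j := \dim (Hj j) in
  let dt j := \dim (Ht j) in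
  let p := \sum_(j < m) q j in
  let BL1 := (\prod_(j < m) wedge_vol w (S :\: C j) `^ q j)
               / (wedge_vol w S `^ (p - 1)) in
  let BL2 := (\prod_(j < m) wedge_vol w (C j) `^ q j) / wedge_vol w S in
  exists2 M : R,
    is_max [set affine_vol (orthv H) x K | x in [set` H]] M &
  [/\ M `^ (p - 1) * vol K >=
        BL1^-1 * ((\prod_(j < m) (dj j)%:R `^ (q j * (dj j)%:R)) / d%:R ^+ d)
          * \prod_(j < m) affine_vol (orthv (Ht j)) 0 K `^ q j,
      M * vol K `^ (p - 1) >=
        BL2^-1 * ((\prod_(j < m) (dt j)%:R `^ (q j * (dt j)%:R))
                    / d%:R `^ (d%:R * (p - 1)))
          * \prod_(j < m) affine_vol (orthv (Hj j)) 0 K `^ q j,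
      M `^ (p - 1) * vol K >=
        BL2^-1 * ((\prod_(j < m) (dj j)%:R `^ (q j * (dj j)%:R)) / d%:R ^+ d)
          * \prod_(j < m) affine_vol (Hj j + orthv H)%VS 0 K `^ q j &
      M * vol K `^ (p - 1) >=
        BL1^-1 * ((\prod_(j < m) (dt j)%:R `^ (q j * (dt j)%:R))
                    / d%:R `^ (d%:R * (p - 1)))
          * \prod_(j < m) affine_vol (Ht j + orthv H)%VS 0 K `^ q j].
Proof.
move=> d H Hj Ht dj dt p BL1 BL2.
have uw := basis_unitmx w_basis.
have [cK convK intK] := K_body.
have K0 : K !=set0 by have [z zK] := intK; exists z; exact: interior_subset zK.
have [_ CS _ _] := cover.
have DS j : S :\: C j \subset S by exact: finset.subsetDl.
pose V := rowsmx (frame w S); pose W := dual_frame w S.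
have uV : V \in unitmx := frame_unit S uw.
have uW : W \in unitmx := dual_frame_unit S uw.
have VG : coord_space V (~: S) (orthv H) := frame_orthv S uw.
have WG : coord_space W (~: S) (orthv H) := dual_frame_orthv uw (subxx S).
have gV : gram_vol V (~: S) = 1 := frame_gram_volC S uw.
have wS_gt0 : 0 < wedge_vol w S.
  by rewrite -(frame_det S uw) normr_gt0 -unitfE -unitmxE.
have gW : gram_vol W (~: S) = 1.
  by rewrite (dual_frame_gram_vol uw (subxx S)) divff// gt_eqF.
have [z zmax] := section_size_max S uV cK K0.
have affE x : affine_vol (orthv H) x K = section_size V K S x.
  exact: affine_vol_section.
(* Moving [z] along the orthogonal complement of [H] keeps its section, so the
   maximum is reached in [H]. *)
pose t := z *m invmx V.
pose x0 := t *m maskmx R S *m V.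
have x0H : x0 \in H.
  apply/(frame_spanv w (subxx S)); exists (t *m maskmx R S) => // i iS.
  by rewrite mul_maskmx (negbTE iS) mulr0.
have zE : section_size V K S x0 = section_size V K S z.
  rewrite -(@section_size_translate _ _ V K S cK x0 (t *m maskmx R (~: S))).
    congr section_size; rewrite /x0 -mulmxDl maskmxC mulmxBr mulmx1 addrC subrK.
    by rewrite /t mulmxKV.
  by move=> i iS; rewrite mul_maskmx (negbTE iS) mulr0.
pose M := affine_vol (orthv H) x0 K.
have maxM x : affine_vol (orthv H) x K <= M.
  by rewrite /M !affE zE; exact: zmax.
exists M.
  by split; [exists x0 | move=> _ [x _ <-]; exact: maxM].
have djE j : dj j = #|C j| := dim_spanv (C j) uw.
have dtE j : dt j = #|S :\: C j| := dim_spanv (S :\: C j) uw.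
have wge0 A : 0 <= wedge_vol w A by rewrite wedge_volE// sqrtr_ge0.
have CE j : C j :|: ~: S = ~: (S :\: C j) by rewrite finset.setCD finset.setUC.
have DE j : (S :\: C j) :|: ~: S = ~: C j.
  apply/finset.setP => i; rewrite !inE; case: (boolP (i \in C j)) => [iC|_] /=.
    by rewrite (fintype.subsetP (CS j) _ iC).
  by case: (i \in S).
have gWT : gram_vol W [set: 'I_n]%SET = (wedge_vol w S)^-1 := dual_frame_gram_volT S uw.
have gVT : gram_vol V [set: 'I_n]%SET = wedge_vol w S := frame_gram_volT S uw.
have -> : \prod_(j < m) (dj j)%:R `^ (q j * (dj j)%:R) =
    \prod_(j < m) #|C j|%:R `^ (q j * #|C j|%:R) :> R.
  by apply: eq_bigr => j _; rewrite djE.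
have -> : \prod_(j < m) (dt j)%:R `^ (q j * (dt j)%:R) =
    \prod_(j < m) #|S :\: C j|%:R `^ (q j * #|S :\: C j|%:R) :> R.
  by apply: eq_bigr => j _; rewrite dtE.
have WC : \prod_(j < m) gram_vol W (C j :|: ~: S) `^ q j =
    \prod_(j < m) (wedge_vol w (S :\: C j) / wedge_vol w S) `^ q j.
  by apply: eq_bigr => j _; rewrite CE (dual_frame_gram_vol uw (DS j)).
have WD : \prod_(j < m) gram_vol W ((S :\: C j) :|: ~: S) `^ q j =
    \prod_(j < m) (wedge_vol w (C j) / wedge_vol w S) `^ q j.
  by apply: eq_bigr => j _; rewrite DE (dual_frame_gram_vol uw (CS j)).
have VC : \prod_(j < m) gram_vol V (C j :|: ~: S) `^ q j =
    \prod_(j < m) wedge_vol w (C j) `^ q j.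
  by apply: eq_bigr => j _; rewrite (frame_gram_vol uw (CS j)).
have VD : \prod_(j < m) gram_vol V ((S :\: C j) :|: ~: S) `^ q j =
    \prod_(j < m) wedge_vol w (S :\: C j) `^ q j.
  by apply: eq_bigr => j _; rewrite (frame_gram_vol uw (DS j)).
split.
- have UF j : coord_space W (C j :|: ~: S) (orthv (Ht j)).
    by rewrite CE => u; exact: (dual_frame_orthv uw (DS j) u).
  have := cover_volume_inequality uW cK convK WG gW maxM cover UF.
  by rewrite gWT WC (dual_constant1 q wS_gt0 (fun j => wge0 _)).
- have UF j : coord_space W ((S :\: C j) :|: ~: S) (orthv (Hj j)).
    by rewrite DE => u; exact: (dual_frame_orthv uw (CS j) u).
  have := cocover_volume_inequality uW cK convK WG gW maxM cover UF.
  by rewrite gWT WD (dual_constant2 q wS_gt0 (fun j => wge0 _)).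
- have UF j : coord_space V (C j :|: ~: S) (Hj j + orthv H)%VS.
    by move=> u; exact: (frame_addv uw (CS j) u).
  have := cover_volume_inequality uV cK convK VG gV maxM cover UF.
  by rewrite gVT VC /BL2 invf_div.
- have UF j : coord_space V ((S :\: C j) :|: ~: S) (Ht j + orthv H)%VS.
    by move=> u; exact: (frame_addv uw (DS j) u).
  have := cocover_volume_inequality uV cK convK VG gV maxM cover UF.
  by rewrite gVT VD /BL1 invf_div.
Qed.
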